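(* Let $n\geq 4$ and let $B\subset\mathbb{R}^{n+1}$ be a symmetric convex body all of whose hyperplane sections are affine symmetric bodies of revolution (not assumed linearly equivalent to each other). Then at least one hyperplane section of $B$ is an ellipsoid.
   Context: A symmetric convex body is a compact convex subset of a finite-dimensional real vector space with nonempty interior, invariant under $x\mapsto -x$. A hyperplane is a codimension-one linear subspace; a hyperplane section of a set is its intersection with a hyperplane. A symmetric convex body $K\subset\mathbb{R}^m$ is a symmetric body of revolution if it admits an axis of revolution: a 1-dimensional linear subspace $L$ such that every section of $K$ by an affine hyperplane $A$ orthogonal to $L$ is a closed Euclidean $(m-1)$-ball in $A$ centered at $A\cap L$ (possibly empty or a point); $L^\perp$ is the associated hyperplane of revolution. An affine symmetric body of revolution is a convex body linearly equivalent (via a linear isomorphism of ambient spaces) to a symmetric body of revolution; images of an axis and its associated hyperplane of revolution are called an axis and associated hyperplane of revolution of it. An ellipsoid is a set affinely equivalent to a closed Euclidean unit ball. *)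

(* Defs.v *)
From Stdlib Require Import Reals.
Open Scope R_scope.

(* Points of R^m are modelled as functions nat -> R vanishing at
   indices >= m; a subset of R^m is a predicate contained in [vec m]. *)
Definition pt := nat -> R.
Definition vec (m : nat) (x : pt) : Prop := forall i, (m <= i)%nat -> x i = 0.

Definition vzero : pt := fun _ => 0.
Definition vadd (x y : pt) : pt := fun i => x i + y i.
Definition vscale (a : R) (x : pt) : pt := fun i => a * x i.
Definition vopp (x : pt) : pt := fun i => - x i.
Definition vsub (x y : pt) : pt := fun i => x i - y i.

Fixpoint dot (m : nat) (x y : pt) : R :=
  match m with
  | O => 0
  | S k => dot k x y + x k * y k
  end.
Definition norm (m : nat) (x : pt) : R := sqrt (dot m x x).

Definition nonzero_vec (x : pt) : Prop := exists i, x i <> 0.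

Definition convex_body (m : nat) (K : pt -> Prop) : Prop :=
  (forall x, K x -> vec m x) /\
  (forall x y t, K x -> K y -> 0 <= t <= 1 ->
     K (vadd (vscale t x) (vscale (1 - t) y))) /\
  (forall x, vec m x ->
     (forall eps, 0 < eps -> exists y, K y /\ norm m (vsub x y) < eps) -> K x) /\
  (exists M, forall x, K x -> norm m x <= M) /\
  (exists x r, 0 < r /\ forall y, vec m y -> norm m (vsub y x) < r -> K y).

Definition sym_convex_body (m : nat) (K : pt -> Prop) : Prop :=
  convex_body m K /\ (forall x, K x -> K (vopp x)).

(* Symmetric body of revolution in R^m with axis span(v), v <> 0:
   every section by an affine hyperplane A_t = {x | <v,x> = t}
   orthogonal to the axis is empty or a closed Euclidean ball in A_t
   (possibly a point) centred at A_t ∩ L = (t/|v|^2) v. *)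
Definition sym_body_of_revolution (m : nat) (K : pt -> Prop) : Prop :=
  sym_convex_body m K /\
  exists v, vec m v /\ nonzero_vec v /\
    forall t : R,
      (forall x, ~ (K x /\ dot m v x = t)) \/
      (exists r, 0 <= r /\
         forall x, (K x /\ dot m v x = t) <->
           (vec m x /\ dot m v x = t /\
            norm m (vsub x (vscale (t / dot m v v) v)) <= r)).

Definition lin_iso_onto (m : nat) (T : pt -> pt) (H : pt -> Prop) : Prop :=
  (forall x, vec m x -> H (T x)) /\
  (forall x y, vec m x -> vec m y -> T (vadd x y) = vadd (T x) (T y)) /\
  (forall a x, vec m x -> T (vscale a x) = vscale a (T x)) /\
  (forall x y, vec m x -> vec m y -> T x = T y -> x = y) /\
  (forall z, H z -> exists x, vec m x /\ T x = z).

Definition hyperplane (m : nat) (u : pt) : pt -> Prop :=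
  fun x => vec m x /\ dot m u x = 0.

Definition section (K H : pt -> Prop) : pt -> Prop := fun x => K x /\ H x.

Definition affine_sym_body_of_revolution (n : nat) (H S : pt -> Prop) : Prop :=
  exists (T : pt -> pt) (K : pt -> Prop),
    lin_iso_onto n T H /\ sym_body_of_revolution n K /\
    forall z, S z <-> exists y, K y /\ T y = z.

Definition ellipsoid (n : nat) (H S : pt -> Prop) : Prop :=
  exists (T : pt -> pt) (c : pt),
    lin_iso_onto n T H /\ H c /\
    forall z, S z <-> exists y, vec n y /\ norm n y <= 1 /\ z = vadd c (T y).

(* Main.v *)
(** Suppose that no hyperplane section is an ellipsoid. For [x <> 0] let [H_x] be the hyperplane of
    revolution of the section by [x^perp] and let [P_x], a plane containing [x], be the orthogonal
    complement of [H_x]. Restricting to the intersection [E] of [x^perp] and [y^perp], the section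
    by [E] is of revolution with hyperplane both [E] meet [H_x] and [E] meet [H_y]; since [dim E >= 3]
    the hyperplane of revolution of a non-ellipsoid is unique, so that [P_x] and [P_y] share a line
    unless [E] cuts [B] in an ellipsoid. A section by [E] containing the axis of [x^perp] is never
    an ellipsoid, and being a non-ellipsoid is an open condition on [E].

    Choose [y] so that [E] contains the axis of [x^perp], and let [p] span the line common to [P_x]
    and [P_y]. Choose [z] outside the 3-space [P_x + P_y] such that the pairs (x, z), (y, z), (p, z)
    are all non-elliptic: this is possible near a vector orthogonal to the axes of the sections
    by [x^perp], [y^perp], [p^perp]. Then [P_z] meets [P_x] and [P_y], hence contains [p], so that
    [H_z] is the intersection of [z^perp] and [p^perp]. But the section by [H_z] is an ellipsoid,
    a contradiction.

    Ellipsoids are recognised by the parallelogram law for the gauge of [B]. *)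

Require Import Defs.
From Stdlib Require Import Reals Lra Lia List Classical FunctionalExtensionality ClassicalEpsilon.
Open Scope R_scope.

(** * Linear algebra *)

Ltac vext := apply functional_extensionality; intro; unfold vadd, vscale, vsub, vopp, vzero.

Lemma vec_add m x y : vec m x -> vec m y -> vec m (vadd x y).
Proof. intros Hx Hy i Hi. unfold vadd. rewrite Hx, Hy by assumption. ring. Qed.

Lemma vec_scale m a x : vec m x -> vec m (vscale a x).
Proof. intros Hx i Hi. unfold vscale. rewrite Hx by assumption. ring. Qed.

Lemma vec_sub m x y : vec m x -> vec m y -> vec m (vsub x y).
Proof. intros Hx Hy i Hi. unfold vsub. rewrite Hx, Hy by assumption. ring. Qed.

Lemma vec_zero m : vec m vzero.
Proof. intros i Hi. reflexivity. Qed.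

#[local] Hint Resolve vec_add vec_scale vec_sub vec_zero : vec.

Lemma dot_sym m x y : dot m x y = dot m y x.
Proof. induction m; simpl; [ring|rewrite IHm; ring]. Qed.

Lemma dot_add_r m x y z : dot m x (vadd y z) = dot m x y + dot m x z.
Proof. induction m; simpl; [ring|rewrite IHm; unfold vadd; ring]. Qed.

Lemma dot_scale_r m x a y : dot m x (vscale a y) = a * dot m x y.
Proof. induction m; simpl; [ring|rewrite IHm; unfold vscale; ring]. Qed.

Lemma dot_sub_r m x y z : dot m x (vsub y z) = dot m x y - dot m x z.
Proof. induction m; simpl; [ring|rewrite IHm; unfold vsub; ring]. Qed.

Lemma dot_add_l m x y z : dot m (vadd y z) x = dot m y x + dot m z x.
Proof. rewrite dot_sym, dot_add_r, !(dot_sym m x). reflexivity. Qed.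

Lemma dot_scale_l m x a y : dot m (vscale a y) x = a * dot m y x.
Proof. rewrite dot_sym, dot_scale_r, (dot_sym m x). reflexivity. Qed.

Lemma dot_sub_l m x y z : dot m (vsub y z) x = dot m y x - dot m z x.
Proof. rewrite dot_sym, dot_sub_r, !(dot_sym m x). reflexivity. Qed.

Lemma dot_zero_r m x : dot m x vzero = 0.
Proof. induction m; simpl; [ring|rewrite IHm; unfold vzero; ring]. Qed.

Lemma dot_zero_l m x : dot m vzero x = 0.
Proof. rewrite dot_sym. apply dot_zero_r. Qed.

Lemma dot_nonneg m x : 0 <= dot m x x.
Proof. induction m; simpl; [lra|]. pose proof (Rle_0_sqr (x m)). unfold Rsqr in *. lra. Qed.

Ltac dots := repeat (rewrite ?dot_add_l, ?dot_add_r, ?dot_sub_l, ?dot_sub_r,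
  ?dot_scale_l, ?dot_scale_r, ?dot_zero_l, ?dot_zero_r).

Lemma dot_self_eq0 m x : vec m x -> dot m x x = 0 -> x = vzero.
Proof.
  intros Hx H. apply functional_extensionality. intro i.
  destruct (Nat.le_gt_cases m i) as [Hi|Hi]; [now apply Hx|].
  clear Hx. induction m; [lia|]. simpl in H.
  pose proof (dot_nonneg m x). pose proof (Rle_0_sqr (x m)) as Hs. unfold Rsqr in Hs.
  assert (x m * x m = 0) by lra.
  destruct (Nat.eq_dec i m) as [->|].
  - unfold vzero. destruct (Rmult_integral _ _ H1); assumption.
  - apply IHm; [lra|lia].
Qed.

Lemma dot_self_pos m x : vec m x -> x <> vzero -> 0 < dot m x x.
Proof.
  intros Hx H. destruct (dot_nonneg m x) as [|E]; [assumption|].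
  exfalso. apply H. now apply (dot_self_eq0 m).
Qed.

Lemma nonzero_vec_iff x : nonzero_vec x <-> x <> vzero.
Proof.
  split.
  - intros [i Hi] ->. now apply Hi.
  - intro H. apply NNPP. intro H'. apply H. vext. apply NNPP. intro E. apply H'. now exists x0.
Qed.

Definition basis_vec (k : nat) : pt := fun i => if Nat.eq_dec i k then 1 else 0.

Lemma vec_basis m k : (k < m)%nat -> vec m (basis_vec k).
Proof. intros H i Hi. unfold basis_vec. destruct (Nat.eq_dec i k); [lia|reflexivity]. Qed.

Lemma dot_vec_trunc m j x y : vec m y -> dot (m + j) x y = dot m x y.
Proof.
  intro Hy. induction j; [now rewrite Nat.add_0_r|].
  rewrite Nat.add_succ_r. simpl. rewrite IHj, (Hy (m + j)%nat) by lia. ring.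
Qed.

Lemma dot_basis_r m k x : (k < m)%nat -> dot m x (basis_vec k) = x k.
Proof.
  intro H. assert (E : forall j, (j <= k)%nat -> dot j x (basis_vec k) = 0).
  { induction j; intro Hj; simpl; [reflexivity|]. rewrite IHj by lia.
    unfold basis_vec. destruct (Nat.eq_dec j k); [lia|ring]. }
  replace m with (S k + (m - S k))%nat by lia.
  rewrite dot_vec_trunc by (apply vec_basis; lia). simpl. rewrite E by lia.
  unfold basis_vec. destruct (Nat.eq_dec k k); [ring|lia].
Qed.

(** Gaussian elimination on the last coordinate. If some [a] in [l] has a nonzero last entry, it
    serves as pivot: the other vectors are cleared of that entry, the smaller system is solved, and
    the last coordinate of [u] is chosen to satisfy the equation of [a]. Otherwise the last basis
    vector works. *)
Lemma exists_orthogonal m (l : list pt) :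
  (length l < m)%nat ->
  exists u, vec m u /\ u <> vzero /\ forall a, In a l -> dot m a u = 0.
Proof.
  revert l. induction m; intros l Hl; [lia|].
  destruct (classic (exists a, In a l /\ a m <> 0)) as [[a [Ha Hm]]|Hn].
  - destruct (in_split a l Ha) as [l1 [l2 ->]].
    destruct (IHm (map (fun b => vsub b (vscale (b m / a m) a)) (l1 ++ l2))) as [u [Hu [Hu0 Hd]]].
    { rewrite length_map. rewrite length_app in *. simpl in Hl. lia. }
    exists (vadd u (vscale (- dot m a u / a m) (basis_vec m))).
    assert (Vu : vec (S m) u) by (intros i Hi; apply Hu; lia).
    assert (Hk : forall b, dot (S m) b (vadd u (vscale (- dot m a u / a m) (basis_vec m)))
       = dot m b u + (- dot m a u / a m) * b m).
    { intro b. dots. rewrite dot_basis_r by lia. simpl. rewrite (Hu m) by lia. ring. }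
    repeat split.
    + apply vec_add; [assumption|]. apply vec_scale, vec_basis. lia.
    + intro E. apply Hu0. vext.
      assert (E' := f_equal (fun f => f x) E). unfold vadd, vscale, vzero, basis_vec in E'.
      destruct (Nat.eq_dec x m) as [->|]; [apply Hu; lia|lra].
    + intros b Hb. rewrite Hk.
      assert (b = a \/ In b (l1 ++ l2)) as [->|Hb'].
      { rewrite in_app_iff in *. simpl in Hb. intuition. }
      * field. assumption.
      * specialize (Hd _ (in_map (fun b => vsub b (vscale (b m / a m) a)) _ _ Hb')).
        simpl in Hd. revert Hd. dots. intro Hd.
        replace (dot m b u) with (b m / a m * dot m a u) by lra. field. assumption.
  - exists (basis_vec m). repeat split.
    + apply vec_basis. lia.
    + intro E. assert (E' := f_equal (fun f => f m) E). unfold vzero, basis_vec in E'.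
      destruct (Nat.eq_dec m m); [lra|lia].
    + intros a Ha. rewrite dot_basis_r by lia. apply NNPP. intro. apply Hn. now exists a.
Qed.

(** * Spans, orthogonal projections and representation of linear forms *)

Inductive span (l : list pt) : pt -> Prop :=
| span_zero : span l vzero
| span_step x c a : span l x -> In a l -> span l (vadd x (vscale c a)).

Lemma span_cons b l x : span l x -> span (b :: l) x.
Proof. induction 1; constructor; simpl; auto. Qed.

Lemma span_add l x y : span l x -> span l y -> span l (vadd x y).
Proof.
  intros Hx Hy. induction Hy.
  - replace (vadd x vzero) with x by (vext; ring). assumption.
  - replace (vadd x (vadd x0 (vscale c a))) with (vadd (vadd x x0) (vscale c a)) by (vext; ring).
    now constructor.
Qed.

Lemma span_scale l c x : span l x -> span l (vscale c x).
Proof.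
  induction 1.
  - replace (vscale c vzero) with vzero by (vext; ring). constructor.
  - replace (vscale c (vadd x (vscale c0 a))) with (vadd (vscale c x) (vscale (c * c0) a))
      by (vext; ring). now constructor.
Qed.

Lemma span_vec m l x : (forall a, In a l -> vec m a) -> span l x -> vec m x.
Proof. intros H Hs. induction Hs; auto with vec. Qed.

Lemma span_in l a : In a l -> span l a.
Proof.
  intro H. replace a with (vadd vzero (vscale 1 a)) by (vext; ring). constructor; [constructor|assumption].
Qed.

Lemma span_orthogonal m l f s :
  (forall a, In a l -> dot m a f = 0) -> span l s -> dot m s f = 0.
Proof.
  intros H Hs. induction Hs; dots; [ring|]. rewrite IHHs, H by assumption. ring.
Qed.

(** Gram-Schmidt for possibly dependent vectors: [b'] is the part of [b] orthogonal to the span of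
    [l]. If it vanishes, [b] contributes nothing; otherwise the projection is corrected along
    [b']. *)
Lemma orthogonal_projection m (l : list pt) :
  (forall a, In a l -> vec m a) ->
  forall x, vec m x -> exists s, span l s /\ forall a, In a l -> dot m a (vsub x s) = 0.
Proof.
  induction l as [|b l IH]; intros Hl x Hx.
  - exists vzero. split; [constructor|intros a []].
  - destruct (IH (fun a H => Hl a (or_intror H)) x Hx) as [s [Hs Ho]].
    destruct (IH (fun a H => Hl a (or_intror H)) b (Hl b (or_introl eq_refl))) as [r [Hr Hro]].
    assert (Vs : vec m s) by (apply (span_vec m l); auto; intros; apply Hl; now right).
    assert (Vr : vec m r) by (apply (span_vec m l); auto; intros; apply Hl; now right).
    assert (Vb : vec m b) by (apply Hl; now left).
    set (b' := vsub b r) in *.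
    assert (Hb' : span (b :: l) b').
    { unfold b'. replace (vsub b r) with (vadd b (vscale (-1) r)) by (vext; ring).
      apply span_add; [apply span_in; now left|apply span_scale, span_cons, Hr]. }
    destruct (classic (b' = vzero)) as [E|NE].
    + exists s. split; [now apply span_cons|]. intros a [<-|Ha]; [|now apply Ho].
      assert (b = r). { assert (H := E). unfold b' in H. vext. assert (H' := f_equal (fun f => f x0) H).
        unfold vsub, vzero in H'. lra. }
      rewrite H. now apply (span_orthogonal m l).
    + set (c := dot m b' (vsub x s) / dot m b' b').
      exists (vadd s (vscale c b')). split.
      { apply span_add; [now apply span_cons|now apply span_scale]. }
      assert (P : 0 < dot m b' b') by (apply dot_self_pos; [unfold b'; auto with vec|assumption]).
      assert (Ol : forall a, In a l -> dot m a (vsub x (vadd s (vscale c b'))) = 0).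
      { intros a Ha. specialize (Ho a Ha). specialize (Hro a Ha). fold b' in Hro.
        rewrite dot_sub_r in *. dots. rewrite Hro. lra. }
      intros a [<-|Ha]; [|now apply Ol].
      assert (Or : dot m r (vsub x (vadd s (vscale c b'))) = 0).
      { now apply (span_orthogonal m l). }
      assert (Ob : dot m b' (vsub x (vadd s (vscale c b'))) = 0).
      { rewrite dot_sub_r, dot_add_r, dot_scale_r. unfold c. rewrite dot_sub_r. field. lra. }
      unfold b' at 1 in Ob. rewrite dot_sub_l, Or in Ob. lra.
Qed.

(** The difference of [x] and its projection to the span works: its product with [x] is its own
    squared length. *)
Lemma exists_separating m (l : list pt) x :
  (forall a, In a l -> vec m a) -> vec m x -> ~ span l x ->
  exists f, vec m f /\ (forall a, In a l -> dot m a f = 0) /\ dot m x f <> 0.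
Proof.
  intros Hl Hx Hn. destruct (orthogonal_projection m l Hl x Hx) as [s [Hs Ho]].
  assert (Vs : vec m s) by (now apply (span_vec m l)).
  exists (vsub x s). repeat split; auto with vec.
  assert (NE : vsub x s <> vzero).
  { intro E. apply Hn. replace x with s; [assumption|]. vext. assert (H' := f_equal (fun f => f x0) E).
    unfold vsub, vzero in H'. lra. }
  assert (P := dot_self_pos m (vsub x s) ltac:(auto with vec) NE).
  assert (Or : dot m s (vsub x s) = 0).
  { now apply (span_orthogonal m l). }
  rewrite dot_sub_l, Or in P. lra.
Qed.

Lemma dot_representation m (phi : pt -> R) :
  (forall x y, vec m x -> vec m y -> phi (vadd x y) = phi x + phi y) ->
  (forall c x, vec m x -> phi (vscale c x) = c * phi x) ->
  exists g, vec m g /\ forall x, vec m x -> phi x = dot m g x.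
Proof.
  revert phi. induction m; intros phi Ha Hs.
  - exists vzero. split; [apply vec_zero|]. intros x Hx.
    replace x with (vscale 0 x). { rewrite Hs by assumption. simpl. ring. }
    vext. rewrite Hx by lia. ring.
  - assert (W : forall x, vec m x -> vec (S m) x) by (intros x H i Hi; apply H; lia).
    destruct (IHm phi) as [g [Hg Hd]]; [auto|auto|].
    exists (vadd g (vscale (phi (basis_vec m)) (basis_vec m))). split.
    { apply vec_add; [auto|]. apply vec_scale, vec_basis. lia. }
    intros x Hx. set (x' := vsub x (vscale (x m) (basis_vec m))).
    assert (Vx' : vec m x').
    { intros i Hi. unfold x', vsub, vscale, basis_vec. destruct (Nat.eq_dec i m) as [->|]; [ring|].
      rewrite Hx by lia. ring. }
    assert (Vb : vec (S m) (basis_vec m)) by (apply vec_basis; lia).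
    replace x with (vadd x' (vscale (x m) (basis_vec m))) at 1 by (unfold x'; vext; ring).
    rewrite Ha, Hs by auto with vec. rewrite Hd by assumption.
    rewrite dot_add_l, dot_scale_l. rewrite (dot_sym (S m) (basis_vec m)), dot_basis_r by lia.
    simpl. rewrite (Hg m) by lia. unfold x'. rewrite dot_sub_r, dot_scale_r.
    replace (dot m g (basis_vec m)) with 0; [ring|].
    symmetry. assert (E := dot_basis_r (S m) m g ltac:(lia)). simpl in E. rewrite (Hg m) in E by lia. lra.
Qed.

(** * Uniqueness of the hyperplane of revolution in dimension three *)

Lemma continuity_pt_pos_near g c : continuity_pt g c -> 0 < g c ->
  exists e, 0 < e /\ forall x, Rabs (x - c) < e -> 0 < g x.
Proof.
  intros Hc Hg. destruct (Hc (g c) Hg) as [e [He H]]. exists e. split; [assumption|].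
  intros x Hx. destruct (Req_dec x c) as [->|Hne]; [assumption|].
  assert (K : Rabs (g x - g c) < g c).
  { apply (H x). split; [split; [exact I|auto]|exact Hx]. }
  apply Rabs_def2 in K. lra.
Qed.

Lemma continuity_pt_zero g c : continuity_pt g c ->
  (forall e, 0 < e -> exists x, Rabs (x - c) < e /\ g x = 0) -> g c = 0.
Proof.
  intros Hc H.
  destruct (Rtotal_order (g c) 0) as [L|[E|L]]; [|assumption|].
  - destruct (continuity_pt_pos_near (fun x => - g x) c) as [e [He Hp]].
    + now apply continuity_pt_opp.
    + lra.
    + destruct (H e He) as [x [Hx E]]. specialize (Hp x Hx). simpl in Hp. lra.
  - destruct (continuity_pt_pos_near g c Hc L) as [e [He Hp]].
    destruct (H e He) as [x [Hx E]]. specialize (Hp x Hx). lra.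
Qed.

(** Real induction: if [P] failed somewhere, the initial segments on which it holds would have a
    finite supremum; closedness includes that supremum and openness passes beyond it. *)
Lemma continuous_induction (P : R -> Prop) (d : R) :
  0 < d ->
  (forall x, 0 <= x <= d -> P x) ->
  (forall c, 0 < c -> (forall x, 0 <= x < c -> P x) -> P c) ->
  (forall c, 0 < c -> (forall x, 0 <= x <= c -> P x) ->
     exists e, 0 < e /\ forall x, c < x < c + e -> P x) ->
  forall x, 0 <= x -> P x.
Proof.
  intros Hd H0 Hcl Hop x Hx. apply NNPP. intro Hn.
  set (S := fun c => 0 <= c /\ forall y, 0 <= y <= c -> P y).
  destruct (completeness S) as [c [Hub Hlub]].
  - exists x. intros c [Hc Hy]. destruct (Rle_dec c x); [assumption|].
    exfalso. apply Hn, Hy. lra.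
  - exists d. split; [lra|assumption].
  - assert (d <= c) by (apply Hub; split; [lra|assumption]).
    assert (Hlt : forall y, 0 <= y < c -> P y).
    { intros y Hy. apply NNPP. intro Hny.
      assert (c <= y); [|lra]. apply Hlub. intros b [Hb Hb'].
      destruct (Rle_dec b y); [assumption|]. exfalso. apply Hny, Hb'. lra. }
    assert (Pc : P c) by (apply Hcl; [lra|assumption]).
    assert (Hle : forall y, 0 <= y <= c -> P y).
    { intros y Hy. destruct (Req_dec y c) as [->|]; [assumption|]. apply Hlt. lra. }
    destruct (Hop c ltac:(lra) Hle) as [e [He Hs]].
    assert (c + e / 2 <= c); [|lra]. apply Hub. split; [lra|].
    intros y Hy. destruct (Rle_dec y c); [apply Hle; lra|apply Hs; lra].
Qed.

(* [F ^ 2] and the quadratic form agree on the cone of slopes [|t| <= c r], where [r ^ 2 = w ^ 2 + s ^ 2].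
   The second revolution carries a point of slope slightly above [c] into the cone, because the form,
   being equal to [F ^ 2], is positive at slope [c]; hence no [c] is maximal. *)
Lemma two_revolutions_spread (F : R -> R -> R -> R) (a K mu : R) :
  (forall c t w s, F (c * t) (c * w) (c * s) = Rabs c * F t w s) ->
  (forall t, 0 < F t 1 0) ->
  continuity (fun t => F t 1 0) ->
  (forall t, continuity (fun w => F t w 0)) ->
  (forall t w s t' w' s', t ^ 2 = t' ^ 2 -> w ^ 2 + s ^ 2 = w' ^ 2 + s' ^ 2 ->
     F t w s = F t' w' s') ->
  (forall t w s t' w' s', (w + a * t) ^ 2 = (w' + a * t') ^ 2 ->
     w ^ 2 + s ^ 2 + K * t ^ 2 = w' ^ 2 + s' ^ 2 + K * t' ^ 2 ->
     F t w s = F t' w' s') ->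
  0 < a -> 0 < mu -> 0 < K + a ^ 2 ->
  (forall t w s, a ^ 2 * t ^ 2 <= w ^ 2 + s ^ 2 ->
     F t w s ^ 2 = mu * (w ^ 2 + s ^ 2 + K * t ^ 2)) ->
  forall t w s, F t w s ^ 2 = mu * (w ^ 2 + s ^ 2 + K * t ^ 2).
Proof.
  intros Hom Pos C1 C2 R1 R2 Ha Hmu HK Hreg.
  set (P := fun x => F x 1 0 ^ 2 = mu * (1 + K * x ^ 2)).
  (* Homogeneity and the first revolution reduce the identity at a point to its slope [|t| / r]. *)
  assert (Hslope : forall t w s, 0 < w ^ 2 + s ^ 2 -> P (Rabs t / sqrt (w ^ 2 + s ^ 2)) ->
     F t w s ^ 2 = mu * (w ^ 2 + s ^ 2 + K * t ^ 2)).
  { intros t w s Hr HP. set (r := sqrt (w ^ 2 + s ^ 2)) in *.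
    assert (Hr0 : 0 < r) by (now apply sqrt_lt_R0).
    assert (Hrr : r * r = w ^ 2 + s ^ 2) by (apply sqrt_sqrt; lra).
    rewrite (R1 t w s (r * (Rabs t / r)) (r * 1) (r * 0)).
    - rewrite Hom, Rpow_mult_distr. unfold P in HP. rewrite HP.
      rewrite pow2_abs. replace (w ^ 2 + s ^ 2) with (r * r).
      replace ((Rabs t / r) ^ 2) with (t ^ 2 / r ^ 2).
      + field. lra.
      + rewrite <- (pow2_abs t). field. lra.
    - rewrite <- (pow2_abs t). field. lra.
    - rewrite <- Hrr. ring. }
  assert (HP : forall x, 0 <= x -> P x).
  { apply (continuous_induction P (/ a)).
    - now apply Rinv_0_lt_compat.
    - intros x Hx. unfold P. rewrite Hreg; [ring|].
      assert (a * x <= 1).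
      { replace 1 with (a * / a) by (field; lra). apply Rmult_le_compat_l; lra. }
      assert (0 <= a * x) by nra. nra.
    - intros c Hc H. unfold P.
      apply Rminus_diag_uniq.
      apply (continuity_pt_zero (fun x => F x 1 0 ^ 2 - mu * (1 + K * x ^ 2)) c).
      + apply continuity_pt_minus.
        * apply (continuity_pt_comp (fun x => F x 1 0) (fun y => y ^ 2)); [apply C1|reg].
        * reg.
      + intros e He. exists (Rmax 0 (c - e / 2)).
        pose proof (Rmax_l 0 (c - e / 2)). pose proof (Rmax_r 0 (c - e / 2)).
        assert (Rmax 0 (c - e / 2) < c) by (apply Rmax_lub_lt; lra).
        split; [apply Rabs_def1; lra|].
        assert (Q := H (Rmax 0 (c - e / 2)) ltac:(lra)). unfold P in Q. lra.
    - intros c Hc H.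
      assert (Kc : 0 < 1 + K * c ^ 2).
      { assert (Q := H c ltac:(lra)). unfold P in Q. pose proof (pow_lt _ 2 (Pos c)). nra. }
      (* For negative [K], the bounds [|K| c ^ 2 < 1] and [|K| < a ^ 2] give [(K c) ^ 2 < a ^ 2]. *)
      assert (aKc : 0 < a + K * c).
      { destruct (Rle_dec 0 K) as [k|k]; [nra|].
        assert ((K * c) ^ 2 < a ^ 2) by nra.
        destruct (Rlt_dec 0 (a + K * c)); [assumption|]. exfalso. nra. }
      (* The amount by which [t] will be lowered. The bound [d <= c] makes the new slope smaller
         than [c]; the other bound makes the new [s ^ 2] nonnegative. Both hold strictly at [x = c],
         hence for [x] near [c]. *)
      set (d := Rmin c ((a + K * c) / (K + a ^ 2))).
      assert (Hd0 : 0 < d). { apply Rmin_pos; [lra|]. apply Rdiv_lt_0_compat; lra. }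
      assert (Hd1 : d <= c) by apply Rmin_l.
      assert (Hd2 : d * (K + a ^ 2) <= a + K * c).
      { replace (a + K * c) with ((a + K * c) / (K + a ^ 2) * (K + a ^ 2)) by (field; lra).
        apply Rmult_le_compat_r; [lra|apply Rmin_r]. }
      clearbody d.
      destruct (continuity_pt_pos_near (fun x => 2 * (a + K * x) - d * (K + a ^ 2)) c)
        as [e1 [He1 N1]]; [reg|lra|].
      destruct (continuity_pt_pos_near
        (fun x => c ^ 2 * (1 + K * (2 * x * d - d ^ 2)) - (x - d) ^ 2) c) as [e2 [He2 N2]]; [reg| |].
      { replace (c ^ 2 * (1 + K * (2 * c * d - d ^ 2)) - (c - d) ^ 2)
          with (d * (2 * c - d) * (1 + K * c ^ 2)) by ring.
        apply Rmult_lt_0_compat; [apply Rmult_lt_0_compat; lra|assumption]. }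
      exists (Rmin e1 e2). split; [now apply Rmin_pos|].
      intros x Hx. pose proof (Rmin_l e1 e2). pose proof (Rmin_r e1 e2).
      specialize (N1 x ltac:(apply Rabs_def1; lra)). specialize (N2 x ltac:(apply Rabs_def1; lra)).
      simpl in N1, N2.
      set (r2 := 1 + K * (2 * x * d - d ^ 2)).
      assert (Hs2 : 0 <= r2 - (1 - a * d) ^ 2).
      { unfold r2. replace (1 + K * (2 * x * d - d ^ 2) - (1 - a * d) ^ 2)
          with (d * (2 * (a + K * x) - d * (K + a ^ 2))) by ring. nra. }
      set (s := sqrt (r2 - (1 - a * d) ^ 2)).
      assert (Hs : s ^ 2 = r2 - (1 - a * d) ^ 2) by (apply pow2_sqrt; assumption).
      assert (Hr : (-1 + a * d) ^ 2 + s ^ 2 = r2) by (rewrite Hs; ring).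
      assert (Hr2 : (x - d) ^ 2 < c ^ 2 * r2) by (unfold r2; lra).
      assert (Hr0 : 0 < r2) by nra.
      unfold P. rewrite (R1 x 1 0 x (-1) 0) by ring.
      (* Raising [w] by [a * d] while lowering [t] by [d] fixes the linear form of the second
         revolution; [s] was chosen so that the quadratic form is fixed too. *)
      rewrite (R2 x (-1) 0 (x - d) (-1 + a * d) s).
      + rewrite Hslope.
        * rewrite Hr. unfold r2. ring.
        * lra.
        * apply H. rewrite Hr. assert (0 < sqrt r2) by (now apply sqrt_lt_R0).
          split.
          -- apply Rmult_le_pos; [apply Rabs_pos|]. left. now apply Rinv_0_lt_compat.
          -- apply Rmult_le_reg_r with (sqrt r2); [assumption|].
             unfold Rdiv. rewrite Rmult_assoc, Rinv_l, Rmult_1_r by lra.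
             apply Rsqr_incr_0_var; [|nra].
             rewrite <- Rsqr_abs, Rsqr_mult, Rsqr_sqrt by lra. unfold Rsqr. nra.
      + ring.
      + rewrite Hr. unfold r2. ring. }
  assert (Hr : forall t w s, 0 < w ^ 2 + s ^ 2 -> F t w s ^ 2 = mu * (w ^ 2 + s ^ 2 + K * t ^ 2)).
  { intros t w s Hp. apply Hslope; [assumption|]. apply HP.
    apply Rmult_le_pos; [apply Rabs_pos|]. left. apply Rinv_0_lt_compat. now apply sqrt_lt_R0. }
  (* Points of the [t]-axis have no finite slope and are reached as limits for [w] tending to 0. *)
  intros t w s. destruct (Rle_lt_dec (w ^ 2 + s ^ 2) 0) as [Hz|]; [|now apply Hr].
  assert (w = 0) by nra. assert (s = 0) by nra. subst.
  apply Rminus_diag_uniq.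
  replace (mu * (0 ^ 2 + 0 ^ 2 + K * t ^ 2)) with (mu * (0 ^ 2 + K * t ^ 2)) by ring.
  apply (continuity_pt_zero (fun w => F t w 0 ^ 2 - mu * (w ^ 2 + K * t ^ 2)) 0).
  - apply continuity_pt_minus; [|reg].
    apply (continuity_pt_comp (fun w => F t w 0) (fun y => y ^ 2)); [apply C2|reg].
  - intros e He. exists (e / 2). split; [apply Rabs_def1; lra|].
    rewrite Hr by nra. ring.
Qed.

(* [q] is the second Euclidean structure, in the coordinates [(t, L, s)] where [L = w + a t] is the
   linear form of the second revolution. *)
Lemma two_revolutions_quadratic (F : R -> R -> R -> R) (a A B C D E G : R) :
  (forall c t w s, F (c * t) (c * w) (c * s) = Rabs c * F t w s) ->
  (forall t, 0 < F t 1 0) ->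
  continuity (fun t => F t 1 0) ->
  (forall t, continuity (fun w => F t w 0)) ->
  (forall t w s t' w' s', t ^ 2 = t' ^ 2 -> w ^ 2 + s ^ 2 = w' ^ 2 + s' ^ 2 ->
     F t w s = F t' w' s') ->
  let q t L s := A * t ^ 2 + 2 * D * t * L + B * L ^ 2 + C * s ^ 2
                 + 2 * E * t * s + 2 * G * L * s in
  (forall t w s t' w' s', (w + a * t) ^ 2 = (w' + a * t') ^ 2 ->
     q t (w + a * t) s = q t' (w' + a * t') s' -> F t w s = F t' w' s') ->
  0 < A -> 0 < C -> (forall t s, 0 <= q t 0 s) ->
  exists al be, forall t w s, F t w s ^ 2 = al * t ^ 2 + be * (w ^ 2 + s ^ 2).
Proof.
  intros Hom Pos C1 C2 R1 q R2 HA HC Hq.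
  set (mu := F 0 0 1 ^ 2). set (K := A / C - a ^ 2).
  assert (Hmu : 0 < mu).
  { unfold mu. rewrite (R1 0 0 1 0 1 0) by ring. apply pow_lt, Pos. }
  assert (HK : A = C * (K + a ^ 2)) by (unfold K; field; lra).
  assert (HK' : 0 < K + a ^ 2) by nra.
  (* On the kernel [L = 0] of its linear form, the second revolution carries every point to a
     multiple of [(0, 0, 1)]. *)
  assert (H2 : forall t s, F t (- a * t) s ^ 2 = mu * (q t 0 s / C)).
  { intros t s. assert (Hnn : 0 <= q t 0 s / C).
    { apply Rmult_le_pos; [apply Hq|]. left. now apply Rinv_0_lt_compat. }
    set (r := sqrt (q t 0 s / C)).
    assert (Hr : r ^ 2 = q t 0 s / C) by (now apply pow2_sqrt).
    rewrite (R2 t (- a * t) s (r * 0) (r * 0) (r * 1)).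
    - rewrite Hom, Rpow_mult_distr, pow2_abs, Hr. fold mu. ring.
    - ring.
    - replace (- a * t + a * t) with 0 by ring.
      replace (q (r * 0) (r * 0 + a * (r * 0)) (r * 1)) with (C * r ^ 2) by (unfold q; ring).
      rewrite Hr. field. lra. }
  (* The first revolution contains the reflection of [s], so [q] has no term in [t * s] on
     [L = 0]. *)
  assert (E0 : E = 0).
  { assert (X : F 1 (- a * 1) 1 = F 1 (- a * 1) (-1)) by (apply R1; ring).
    pose proof (H2 1 1) as X1. pose proof (H2 1 (-1)) as X2. rewrite X in X1.
    rewrite X1 in X2. apply Rmult_eq_reg_l in X2; [|lra].
    apply Rmult_eq_reg_r in X2; [|apply Rinv_neq_0_compat; lra]. unfold q in X2. lra. }
  (* The condition on [t] says exactly that the first revolution can move the point into the plane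
     [L = 0]. *)
  assert (Hreg : forall t w s, a ^ 2 * t ^ 2 <= w ^ 2 + s ^ 2 ->
     F t w s ^ 2 = mu * (w ^ 2 + s ^ 2 + K * t ^ 2)).
  { intros t w s H. set (s1 := sqrt (w ^ 2 + s ^ 2 - a ^ 2 * t ^ 2)).
    assert (Hs : s1 ^ 2 = w ^ 2 + s ^ 2 - a ^ 2 * t ^ 2) by (apply pow2_sqrt; lra).
    rewrite (R1 t w s t (- a * t) s1); [|ring|rewrite Hs; ring].
    rewrite H2. unfold q. rewrite Hs, E0, HK. field. lra. }
  (* At [t = 0] and [L = 1], [q] takes equal values at [s = 0] and [s = - 2 * G / C], whereas [Hreg]
     distinguishes these points unless they coincide. *)
  assert (G0 : G = 0).
  { assert (X : F 0 1 0 = F 0 1 (- 2 * G / C)).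
    { apply R2; [ring|]. unfold q. field. lra. }
    pose proof (Hreg 0 1 0 ltac:(nra)) as X1.
    pose proof (Hreg 0 1 (- 2 * G / C)) as X2.
    assert (Y := Rle_0_sqr (- 2 * G / C)). unfold Rsqr in Y.
    specialize (X2 ltac:(nra)). rewrite <- X, X1 in X2.
    apply Rmult_eq_reg_l in X2; [|lra].
    assert (Z : - 2 * G / C = 0) by nra.
    apply Rmult_integral in Z. destruct Z as [Z|Z]; [lra|].
    exfalso. revert Z. apply Rinv_neq_0_compat. lra. }
  (* The hypothesis makes [q] agree at [t] and [t'] on [L = 1]. Taking [s] large puts both points in
     the region covered by [Hreg], and the two values are compared. *)
  assert (HD : forall t t', A * (t + t') = - 2 * D ->
     (t - t') * (- 2 * a + (K + a ^ 2) * (t + t')) = 0).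
  { intros t t' H.
    set (s := Rabs (a * t) + Rabs (a * t')).
    assert (Hs1 : a ^ 2 * t ^ 2 <= s ^ 2).
    { replace (a ^ 2 * t ^ 2) with (Rabs (a * t) ^ 2) by (rewrite pow2_abs; ring).
      apply pow_incr. unfold s. pose proof (Rabs_pos (a * t)). pose proof (Rabs_pos (a * t')). lra. }
    assert (Hs2 : a ^ 2 * t' ^ 2 <= s ^ 2).
    { replace (a ^ 2 * t' ^ 2) with (Rabs (a * t') ^ 2) by (rewrite pow2_abs; ring).
      apply pow_incr. unfold s. pose proof (Rabs_pos (a * t)). pose proof (Rabs_pos (a * t')). lra. }
    assert (X : F t (1 - a * t) s = F t' (1 - a * t') s).
    { apply R2; [ring|]. replace (1 - a * t + a * t) with 1 by ring.
      replace (1 - a * t' + a * t') with 1 by ring. unfold q. rewrite E0, G0.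
      assert (A * t ^ 2 - A * t' ^ 2 = - 2 * D * (t - t')) by (rewrite <- H; ring). lra. }
    assert (X1 := Hreg t (1 - a * t) s ltac:(pose proof (pow2_ge_0 (1 - a * t)); lra)).
    assert (X2 := Hreg t' (1 - a * t') s ltac:(pose proof (pow2_ge_0 (1 - a * t')); lra)).
    rewrite X, X2 in X1. apply Rmult_eq_reg_l in X1; [|lra]. lra. }
  assert (D0 : D = - a * C).
  { destruct (Req_dec D 0) as [Z|Z].
    - assert (X := HD 1 (-1) ltac:(rewrite Z; ring)). assert (a = 0) as -> by lra. lra.
    - assert (X := HD 0 (- 2 * D / A) ltac:(field; lra)).
      apply Rmult_integral in X. destruct X as [X|X].
      + exfalso. apply Z. apply Rmult_eq_reg_r with (2 / A).
        * unfold Rdiv in *. lra.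
        * apply Rgt_not_eq. apply Rdiv_lt_0_compat; lra.
      + apply Rmult_eq_reg_r with (2 / A); [|apply Rgt_not_eq; apply Rdiv_lt_0_compat; lra].
        replace (K + a ^ 2) with (A / C) in X by (rewrite HK; field; lra).
        replace (- 2 * a + A / C * (0 + - 2 * D / A)) with (- 2 * a - 2 * D / C) in X by (field; lra).
        assert (D / C = - a) by lra. replace D with (C * (D / C)) by (field; lra). rewrite H. field. lra. }
  (* Up to a factor and a multiple of the squared linear form, [q] is the quadratic form of [Hreg];
     the second revolution may thus be stated with that form. *)
  assert (Hqq : forall t w s, q t (w + a * t) s =
     C * (w ^ 2 + s ^ 2 + K * t ^ 2) + (B - C) * (w + a * t) ^ 2).
  { intros. unfold q. rewrite E0, G0, D0, HK. ring. }
  assert (R2' : forall t w s t' w' s', (w + a * t) ^ 2 = (w' + a * t') ^ 2 ->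
     w ^ 2 + s ^ 2 + K * t ^ 2 = w' ^ 2 + s' ^ 2 + K * t' ^ 2 ->
     F t w s = F t' w' s').
  { intros t w s t' w' s' X Y. apply R2; [assumption|]. rewrite !Hqq, X, Y. reflexivity. }
  exists (mu * K), mu. intros t w s.
  replace (mu * K * t ^ 2 + mu * (w ^ 2 + s ^ 2)) with (mu * (w ^ 2 + s ^ 2 + K * t ^ 2)) by ring.
  destruct (Rtotal_order a 0) as [L|[Z|L]].
  (* Reflecting [t], which the first revolution allows, changes the sign of [a]. *)
  - apply (two_revolutions_spread F (- a) K mu); auto; try lra.
    + intros t1 w1 s1 t2 w2 s2 X Y. rewrite (R1 t1 w1 s1 (- t1) w1 s1) by ring.
      rewrite (R1 t2 w2 s2 (- t2) w2 s2) by ring.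
      apply R2'; [|lra]. replace (w1 + a * - t1) with (w1 + - a * t1) by ring.
      rewrite X. ring.
    + intros t1 w1 s1 X. apply Hreg. replace (a ^ 2) with ((- a) ^ 2) by ring. assumption.
  - apply Hreg. rewrite Z. pose proof (pow2_ge_0 w). pose proof (pow2_ge_0 s). lra.
  - apply (two_revolutions_spread F a K mu); auto.
Qed.

(** * The gauge of a symmetric convex body *)

Lemma norm_scale m c x : norm m (vscale c x) = Rabs c * norm m x.
Proof.
  unfold norm. dots. replace (c * (c * dot m x x)) with (Rsqr c * dot m x x) by (unfold Rsqr; ring).
  rewrite sqrt_mult; [|apply Rle_0_sqr|apply dot_nonneg]. now rewrite sqrt_Rsqr_abs.
Qed.

Lemma norm_nonneg m x : 0 <= norm m x.
Proof. apply sqrt_pos. Qed.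

Lemma norm_eq0 m x : vec m x -> norm m x = 0 -> x = vzero.
Proof. intros Hx H. apply (dot_self_eq0 m); [assumption|]. apply sqrt_eq_0; [apply dot_nonneg|assumption]. Qed.

Lemma dot_ext m x x' y y' : (forall i, (i < m)%nat -> x i = x' i) ->
  (forall i, (i < m)%nat -> y i = y' i) -> dot m x y = dot m x' y'.
Proof.
  intros Hx Hy. induction m; simpl; [reflexivity|]. rewrite IHm by auto.
  rewrite Hx, Hy by lia. reflexivity.
Qed.

Definition gauge (m : nat) (B : pt -> Prop) (N : pt -> R) : Prop :=
  (forall x, vec m x -> 0 <= N x) /\
  (forall c x, vec m x -> N (vscale c x) = Rabs c * N x) /\
  (forall x y, vec m x -> vec m y -> N (vadd x y) <= N x + N y) /\
  (forall x, vec m x -> N x = 0 -> x = vzero) /\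
  (forall x, vec m x -> (B x <-> N x <= 1)).

(** By symmetry a ball about some [x] also gives one about [- x], and [y] is the midpoint of [x + y]
    and [- (x - y)]. *)
Lemma sym_convex_body_ball m B : sym_convex_body m B ->
  exists r, 0 < r /\ forall y, vec m y -> norm m y < r -> B y.
Proof.
  intros [[Hv [Hc [_ [_ [x0 [r [Hr Hb]]]]]]] Hs].
  exists r. split; [assumption|]. intros y Hy Hn.
  (* The centre [x0] is not known to satisfy [vec m]; [norm m] sees only its truncation. *)
  set (x := fun i => if Nat.ltb i m then x0 i else 0).
  assert (Vx : vec m x).
  { intros i Hi. unfold x. destruct (Nat.ltb_spec i m); [lia|reflexivity]. }
  assert (Ex : forall i, (i < m)%nat -> x i = x0 i).
  { intros i Hi. unfold x. destruct (Nat.ltb_spec i m); [reflexivity|lia]. }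
  assert (B1 : B (vadd x y)).
  { apply Hb; [auto with vec|]. unfold norm in *.
    rewrite (dot_ext m _ y _ y); [assumption| |];
      intros i Hi; unfold vsub, vadd; rewrite Ex by assumption; ring. }
  assert (B2 : B (vsub x y)).
  { apply Hb; [auto with vec|]. unfold norm in *.
    rewrite (dot_ext m _ (vscale (-1) y) _ (vscale (-1) y)).
    - dots. replace (-1 * (-1 * dot m y y)) with (dot m y y) by ring. assumption.
    - intros i Hi; unfold vsub, vscale; rewrite Ex by assumption; ring.
    - intros i Hi; unfold vsub, vscale; rewrite Ex by assumption; ring. }
  replace y with (vadd (vscale (1 / 2) (vadd x y)) (vscale (1 - 1 / 2) (vopp (vsub x y))))
    by (vext; field).
  apply Hc; [assumption|now apply Hs|lra].
Qed.

(** [nu] is the infimum of the factors [s] with [x] in [s B], obtained as a supremum of their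
    negatives. Closedness of [B] makes every positive [s >= nu] admissible, including [nu] itself
    when positive. *)
Lemma gauge_value_exists m B x : sym_convex_body m B -> vec m x ->
  exists nu, 0 <= nu /\ forall s, 0 < s -> (B (vscale (/ s) x) <-> nu <= s).
Proof.
  intros HB Hx. destruct (sym_convex_body_ball m B HB) as [r [Hr Hball]].
  destruct HB as [[Hv [Hc [Hcl _]]] Hs].
  assert (B0 : B vzero).
  { apply Hball; [apply vec_zero|]. unfold norm. rewrite dot_zero_r, sqrt_0. assumption. }
  assert (Bsc : forall y c, B y -> 0 <= c <= 1 -> B (vscale c y)).
  { intros y c Hy Hcc. replace (vscale c y) with (vadd (vscale c y) (vscale (1 - c) vzero)) by (vext; ring).
    now apply Hc. }
  destruct (completeness (fun s => s <= 0 /\ (s < 0 /\ B (vscale (/ (- s)) x)))) as [l [Hub Hlub]].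
  - exists 0. intros s [H _]. assumption.
  - set (s := (norm m x + 1) / r).
    pose proof (norm_nonneg m x).
    assert (0 < s) by (apply Rdiv_lt_0_compat; lra).
    exists (- s). repeat split; try lra. rewrite Ropp_involutive. apply Hball; [auto with vec|].
    rewrite norm_scale, Rabs_right by (left; now apply Rinv_0_lt_compat).
    unfold s. apply Rmult_lt_reg_r with ((norm m x + 1) / r); [assumption|].
    replace (/ ((norm m x + 1) / r) * norm m x * ((norm m x + 1) / r)) with (norm m x) by (field; lra).
    replace (r * ((norm m x + 1) / r)) with (norm m x + 1) by (field; lra). lra.
  - assert (Hl : l <= 0) by (apply Hlub; intros s [H _]; assumption).
    exists (- l). split; [lra|]. intros s Hs0. split.
    + intro H. assert (- s <= l); [|lra]. apply Hub. rewrite Ropp_involutive. repeat split; try lra. assumption.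
    + intro H. apply Hcl; [auto with vec|]. intros eps He.
      set (y := vscale (/ s) x). pose proof (norm_nonneg m y) as Hy.
      set (eta := Rmin (1 / 2) (eps / (norm m y + 1))).
      assert (E1 : 0 < eta). { apply Rmin_pos; [lra|]. apply Rdiv_lt_0_compat; lra. }
      assert (E2 : eta <= 1 / 2) by apply Rmin_l.
      assert (E3 : eta * (norm m y + 1) <= eps).
      { replace eps with (eps / (norm m y + 1) * (norm m y + 1)) by (field; lra).
        apply Rmult_le_compat_r; [lra|apply Rmin_r]. }
      clearbody eta.
      exists (vscale (1 - eta) y). split.
      (* Otherwise [- s / (1 - eta)] would bound the negated factors from above, contradicting
         [- l <= s]. *)
      * assert (exists s1, 0 < s1 /\ s1 * (1 - eta) <= s /\ B (vscale (/ s1) x)) as [s1 [P1 [P2 P3]]].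
        { apply NNPP. intro Hn.
          assert (K : l <= - (s / (1 - eta))).
          { apply Hlub. intros b [_ [Hb HBb]]. apply NNPP. intro Hlt. apply Hn.
            exists (- b). repeat split; [lra| |assumption].
            apply Rmult_le_reg_r with (/ (1 - eta)); [apply Rinv_0_lt_compat; lra|].
            rewrite Rmult_assoc, Rinv_r, Rmult_1_r by lra. fold (s / (1 - eta)). lra. }
          assert (K2 : s / (1 - eta) <= s) by lra.
          apply (Rmult_le_compat_r (1 - eta)) in K2; [|lra].
          unfold Rdiv in K2. rewrite Rmult_assoc, Rinv_l, Rmult_1_r in K2 by lra. nra. }
        replace (vscale (1 - eta) y) with (vscale (s1 * (1 - eta) / s) (vscale (/ s1) x)).
        { apply Bsc; [assumption|]. split.
          - apply Rmult_le_pos; [nra|]. left. now apply Rinv_0_lt_compat.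
          - apply Rmult_le_reg_r with s; [assumption|]. unfold Rdiv.
            rewrite Rmult_assoc, Rinv_l by lra. lra. }
        unfold y. vext. field. lra.
      * replace (vsub y (vscale (1 - eta) y)) with (vscale eta y) by (vext; ring).
        rewrite norm_scale, Rabs_right by lra. nra.
Qed.

(** The Minkowski functional: symmetry gives homogeneity for negative scalars, convexity the
    triangle inequality, and boundedness definiteness. *)
Lemma gauge_exists m B : sym_convex_body m B -> exists N, gauge m B N.
Proof.
  intro HB.
  set (N := fun x => epsilon (inhabits 0)
    (fun nu => 0 <= nu /\ forall s, 0 < s -> (B (vscale (/ s) x) <-> nu <= s))).
  assert (HN : forall x, vec m x -> 0 <= N x /\ forall s, 0 < s -> (B (vscale (/ s) x) <-> N x <= s)).
  { intros x Hx. unfold N.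
    exact (epsilon_spec (inhabits 0)
      (fun nu => 0 <= nu /\ forall s, 0 < s -> (B (vscale (/ s) x) <-> nu <= s))
      (gauge_value_exists m B x HB Hx)). }
  clearbody N.
  destruct (sym_convex_body_ball m B HB) as [r [Hr Hball]].
  destruct HB as [[Hv [Hc [_ [[M HM] _]]]] Hs].
  assert (B0 : B vzero).
  { apply Hball; [apply vec_zero|]. unfold norm. rewrite dot_zero_r, sqrt_0. assumption. }
  assert (Hpos : forall c x, 0 < c -> vec m x -> N (vscale c x) <= c * N x).
  { intros c x Hcp Hx. destruct (HN x Hx) as [P1 P2].
    destruct (HN (vscale c x) ltac:(auto with vec)) as [Q1 Q2].
    apply le_epsilon. intros eps He.
    apply Q2; [nra|]. replace (vscale (/ (c * N x + eps)) (vscale c x)) with (vscale (/ (N x + eps / c)) x).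
    - assert (0 < eps / c) by (now apply Rdiv_lt_0_compat). apply P2; lra.
    - assert (0 <= c * N x) by (apply Rmult_le_pos; lra). vext. field. repeat split; lra. }
  assert (Hopp : forall x, vec m x -> N (vscale (-1) x) <= N x).
  { intros x Hx. destruct (HN x Hx) as [P1 P2].
    destruct (HN (vscale (-1) x) ltac:(auto with vec)) as [Q1 Q2].
    apply le_epsilon. intros eps He. apply Q2; [lra|].
    replace (vscale (/ (N x + eps)) (vscale (-1) x)) with (vopp (vscale (/ (N x + eps)) x)) by (vext; ring).
    apply Hs, P2; lra. }
  assert (Hzero : N vzero = 0).
  { destruct (HN vzero ltac:(apply vec_zero)) as [P1 P2]. apply Rle_antisym; [|assumption].
    apply le_epsilon. intros eps He. apply P2; [lra|].
    replace (vscale (/ (0 + eps)) vzero) with vzero by (vext; ring). assumption. }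
  assert (Hpos' : forall c x, 0 < c -> vec m x -> N (vscale c x) = c * N x).
  { intros c x Hcp Hx. apply Rle_antisym; [now apply Hpos|].
    assert (H := Hpos (/ c) (vscale c x) ltac:(now apply Rinv_0_lt_compat) ltac:(auto with vec)).
    replace (vscale (/ c) (vscale c x)) with x in H by (vext; field; lra).
    apply (Rmult_le_compat_l c) in H; [|lra]. rewrite <- Rmult_assoc, Rinv_r, Rmult_1_l in H by lra.
    assumption. }
  assert (Hopp' : forall x, vec m x -> N (vscale (-1) x) = N x).
  { intros x Hx. apply Rle_antisym; [now apply Hopp|].
    assert (H := Hopp (vscale (-1) x) ltac:(auto with vec)).
    replace (vscale (-1) (vscale (-1) x)) with x in H by (vext; ring). assumption. }
  exists N. repeat split.
  - intros x Hx. now apply HN.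
  - intros c x Hx. destruct (Rtotal_order c 0) as [L|[->|L]].
    + replace (vscale c x) with (vscale (- c) (vscale (-1) x)) by (vext; ring).
      rewrite Hpos' by (auto with vec; lra). rewrite Hopp' by assumption.
      rewrite Rabs_left by assumption. reflexivity.
    + replace (vscale 0 x) with vzero by (vext; ring). rewrite Hzero, Rabs_R0. ring.
    + rewrite Hpos' by assumption. rewrite Rabs_right by lra. reflexivity.
  - intros x y Hx Hy. destruct (HN x Hx) as [P1 P2]. destruct (HN y Hy) as [Q1 Q2].
    apply le_epsilon. intros eps He.
    apply (HN (vadd x y)); [auto with vec|lra|].
    set (s1 := N x + eps / 2). set (s2 := N y + eps / 2).
    assert (0 < s1) by (unfold s1; lra). assert (0 < s2) by (unfold s2; lra).
    replace (N x + N y + eps) with (s1 + s2) by (unfold s1, s2; lra).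
    replace (vscale (/ (s1 + s2)) (vadd x y)) with
      (vadd (vscale (s1 / (s1 + s2)) (vscale (/ s1) x))
            (vscale (1 - s1 / (s1 + s2)) (vscale (/ s2) y))) by (vext; field; lra).
    apply Hc.
    + apply P2; [assumption|unfold s1; lra].
    + apply Q2; [assumption|unfold s2; lra].
    + split.
      * apply Rmult_le_pos; [lra|]. left. apply Rinv_0_lt_compat. lra.
      * apply Rmult_le_reg_r with (s1 + s2); [lra|]. unfold Rdiv.
        rewrite Rmult_assoc, Rinv_l by lra. lra.
  - intros x Hx H0. apply (norm_eq0 m); [assumption|]. pose proof (norm_nonneg m x).
    destruct (Rle_lt_dec (norm m x) 0); [lra|]. exfalso.
    (* Dividing [x] by this [s] gives a point of [B] of norm [Rabs M + 1], beyond the bound [M]. *)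
    set (s := norm m x / (Rabs M + 1)). pose proof (Rabs_pos M).
    assert (Hs0 : 0 < s) by (apply Rdiv_lt_0_compat; lra).
    assert (HB : B (vscale (/ s) x)) by (apply (HN x Hx); [assumption|lra]).
    apply HM in HB. rewrite norm_scale, Rabs_right in HB by (left; now apply Rinv_0_lt_compat).
    unfold s in HB. replace (/ (norm m x / (Rabs M + 1)) * norm m x) with (Rabs M + 1) in HB by (field; lra).
    pose proof (Rle_abs M). lra.
  - intro H0. apply (HN x H); [lra|]. replace (vscale (/ 1) x) with x by (vext; field). assumption.
  - intro H0. apply (HN x H) in H0; [|lra]. replace (vscale (/ 1) x) with x in H0 by (vext; field). assumption.
Qed.

(* The body of revolution in coordinates [T] of the hyperplane orthogonal to [u]:
   the axis is spanned by [T v]. *)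
Definition revolution (n : nat) (N : pt -> R) (u : pt) (T : pt -> pt) (v : pt) : Prop :=
  lin_iso_onto n T (hyperplane (S n) u) /\ vec n v /\ v <> vzero /\
  forall a b, vec n a -> vec n b ->
    dot n v a ^ 2 = dot n v b ^ 2 -> dot n a a = dot n b b -> N (T a) = N (T b).

(** Slices of [K] are centred balls, so membership depends only on the height along [v] and the
    length. Rescaling turns this into equality of gauges, and evenness of [N] allows heights to be
    compared up to sign. *)
Lemma affine_revolution n B N u :
  gauge (S n) B N ->
  affine_sym_body_of_revolution n (hyperplane (S n) u) (section B (hyperplane (S n) u)) ->
  exists T v, revolution n N u T v.
Proof.
  intros [Gp [Gs [_ [_ GB]]]] [T [K [HT [[HK [v [Vv [Hv0 Hv]]]] HS]]]].
  exists T, v. pose proof HT as [T1 [T2 [T3 [T4 T5]]]].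
  split; [assumption|]. split; [assumption|]. split; [now apply nonzero_vec_iff|].
  assert (HKB : forall y, vec n y -> (K y <-> N (T y) <= 1)).
  { intros y Hy. destruct (T1 y Hy) as [Vy Oy]. rewrite <- GB by assumption. split.
    - intro H. apply (HS (T y)). now exists y.
    - intro H. assert (H' : section B (hyperplane (S n) u) (T y)) by (split; [assumption|now apply T1]).
      apply HS in H'. destruct H' as [y' [Ky' E]].
      assert (Vy' : vec n y') by (apply HK; assumption). now rewrite <- (T4 y' y Vy' Hy E). }
  assert (Main : forall a b, vec n a -> vec n b -> dot n v a = dot n v b -> dot n a a = dot n b b ->
     N (T a) <= N (T b)).
  { intros a b Va Vb E1 E2. apply le_epsilon. intros eps He.
    assert (Pb := Gp (T b) (proj1 (T1 b Vb))).
    set (s := N (T b) + eps). assert (Hs : 0 < s) by (unfold s; lra).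
    assert (Hsc : forall c, vec n c -> (K (vscale (/ s) c) <-> N (T c) <= s)).
    { intros c Vc. rewrite HKB by auto with vec. rewrite T3 by assumption.
      rewrite Gs by (now apply T1). rewrite Rabs_right by (left; now apply Rinv_0_lt_compat).
      split; intro H.
      - apply (Rmult_le_compat_l s) in H; [|lra]. rewrite <- Rmult_assoc, Rinv_r in H; lra.
      - apply (Rmult_le_reg_l s); [assumption|]. rewrite <- Rmult_assoc, Rinv_r; lra. }
    apply Hsc; [assumption|].
    assert (Kb : K (vscale (/ s) b)) by (apply Hsc; [assumption|unfold s; lra]).
    destruct (Hv (dot n v (vscale (/ s) b))) as [Hemp|[r [Hr Hball]]].
    { exfalso. now apply (Hemp (vscale (/ s) b)). }
    destruct (proj1 (Hball _) (conj Kb eq_refl)) as [_ [_ Hn]].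
    apply Hball. split; [auto with vec|]. split.
    { dots. now rewrite E1. }
    revert Hn. unfold norm. dots. rewrite (dot_sym n a v), (dot_sym n b v), E1, E2. tauto. }
  assert (Main2 : forall a b, vec n a -> vec n b -> dot n v a = dot n v b -> dot n a a = dot n b b ->
     N (T a) = N (T b)).
  { intros a b Va Vb E1 E2. apply Rle_antisym; apply Main; auto. }
  intros a b Va Vb E1 E2.
  assert (dot n v a = dot n v b \/ dot n v a = - dot n v b) as [E|E].
  { assert (H : (dot n v a - dot n v b) * (dot n v a + dot n v b) = 0) by lra.
    apply Rmult_integral in H. destruct H; [left|right]; lra. }
  - now apply Main2.
  - rewrite (Main2 a (vscale (-1) b)); auto with vec.
    + rewrite T3, Gs by (try apply T1; assumption). rewrite Rabs_left by lra. ring.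
    + dots. lra.
    + dots. lra.
Qed.

(** * Sections of bodies of revolution *)

Lemma gauge_continuity m B N p q : gauge m B N -> vec m p -> vec m q ->
  continuity (fun t => N (vadd p (vscale t q))).
Proof.
  intros [Gp [Gs [Gt _]]] Vp Vq t e He.
  assert (Hq := Gp q Vq).
  (* [N] is Lipschitz along the line with constant [N q]; the added 1 avoids division by zero. *)
  exists (e / (N q + 1)). split; [apply Rdiv_lt_0_compat; lra|].
  intros t' [_ Hd]. simpl in *. unfold Rdist in *.
  assert (Hlip : forall a b, N (vadd p (vscale a q)) <= N (vadd p (vscale b q)) + Rabs (a - b) * N q).
  { intros a b. rewrite <- Gs by assumption.
    replace (vadd p (vscale a q)) with (vadd (vadd p (vscale b q)) (vscale (a - b) q)) by (vext; ring).
    apply Gt; auto with vec. }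
  pose proof (Hlip t t') as H1. pose proof (Hlip t' t) as H2. rewrite Rabs_minus_sym in H1.
  assert (Rabs (t' - t) * (N q + 1) < e).
  { replace e with (e / (N q + 1) * (N q + 1)) by (field; lra).
    apply Rmult_lt_compat_r; lra. }
  pose proof (Rabs_pos (t' - t)). apply Rabs_def1; nra.
Qed.

(** The algebraic form of an elliptic section by the intersection of [x^perp] and [y^perp]. The case
    [x = y] treats a hyperplane section. *)
Definition parallelogram (m : nat) (N : pt -> R) (x y : pt) : Prop :=
  forall a b, vec m a -> vec m b -> dot m x a = 0 -> dot m y a = 0 ->
    dot m x b = 0 -> dot m y b = 0 ->
    N (vadd a b) ^ 2 + N (vsub a b) ^ 2 = 2 * N a ^ 2 + 2 * N b ^ 2.

Lemma parallelogram_sym m N x y : parallelogram m N x y -> parallelogram m N y x.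
Proof. intros H a b **. now apply H. Qed.

Lemma lin_iso_sub n T H a b : lin_iso_onto n T H -> vec n a -> vec n b ->
  T (vsub a b) = vsub (T a) (T b).
Proof.
  intros [_ [T2 [T3 _]]] Va Vb.
  replace (vsub a b) with (vadd a (vscale (-1) b)) by (vext; ring).
  rewrite T2, T3 by auto with vec. vext. ring.
Qed.

Lemma lin_iso_zero n T H : lin_iso_onto n T H -> T vzero = vzero.
Proof.
  intros [_ [_ [T3 _]]]. replace vzero with (vscale 0 vzero) at 1 by (vext; ring).
  rewrite T3 by apply vec_zero. vext. ring.
Qed.

Lemma lin_iso_eq0 n T H a : lin_iso_onto n T H -> vec n a -> T a = vzero -> a = vzero.
Proof.
  intros HT Va E. pose proof HT as [_ [_ [_ [T4 _]]]]. apply T4; auto with vec.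
  now rewrite (lin_iso_zero n T H HT).
Qed.

Lemma functional_pullback n T H z : lin_iso_onto n T H ->
  exists g, vec n g /\ forall a, vec n a -> dot n g a = dot (S n) z (T a).
Proof.
  intros [_ [T2 [T3 _]]].
  destruct (dot_representation n (fun a => dot (S n) z (T a))) as [g [Vg Hg]].
  - intros a b Va Vb. rewrite T2 by assumption. apply dot_add_r.
  - intros c a Va. rewrite T3 by assumption. apply dot_scale_r.
  - exists g. split; [assumption|]. intros a Va. now rewrite Hg.
Qed.

(** The form [dot n v] composed with the inverse of [T] lives on [u^perp]; composing further with
    the orthogonal projection [pr] extends it to the ambient space, where it is represented by a
    vector. *)
Lemma functional_pushforward n T u v :
  lin_iso_onto n T (hyperplane (S n) u) -> vec (S n) u -> u <> vzero ->
  exists l, vec (S n) l /\ forall a, vec n a -> dot (S n) l (T a) = dot n v a.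
Proof.
  intros [T1 [T2 [T3 [T4 T5]]]] Vu Hu.
  assert (Pu := dot_self_pos _ _ Vu Hu).
  set (Ti := fun z => epsilon (inhabits vzero) (fun x => vec n x /\ T x = z)).
  assert (HTi : forall z, hyperplane (S n) u z -> vec n (Ti z) /\ T (Ti z) = z).
  { intros z Hz. unfold Ti. exact (epsilon_spec (inhabits vzero) (fun x => vec n x /\ T x = z) (T5 z Hz)). }
  clearbody Ti.
  set (pr := fun z => vsub z (vscale (dot (S n) u z / dot (S n) u u) u)).
  assert (Hpr : forall z, vec (S n) z -> hyperplane (S n) u (pr z)).
  { intros z Vz. unfold pr. split; [auto with vec|]. dots. field. lra. }
  destruct (dot_representation (S n) (fun z => dot n v (Ti (pr z)))) as [l [Vl Hl]].
  - intros x y Vx Vy. rewrite <- dot_add_r. f_equal.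
    destruct (HTi _ (Hpr x Vx)) as [Ax Bx]. destruct (HTi _ (Hpr y Vy)) as [Ay By].
    destruct (HTi _ (Hpr (vadd x y) ltac:(auto with vec))) as [Axy Bxy].
    apply T4; auto with vec. rewrite T2, Bx, By, Bxy by assumption.
    unfold pr. rewrite dot_add_r. vext. field. lra.
  - intros c x Vx. rewrite <- dot_scale_r. f_equal.
    destruct (HTi _ (Hpr x Vx)) as [Ax Bx].
    destruct (HTi _ (Hpr (vscale c x) ltac:(auto with vec))) as [Axy Bxy].
    apply T4; auto with vec. rewrite T3, Bx, Bxy by assumption.
    unfold pr. rewrite dot_scale_r. vext. field. lra.
  - exists l. split; [assumption|]. intros a Va. destruct (T1 a Va) as [VTa OTa].
    rewrite <- Hl by assumption. f_equal.
    destruct (HTi _ (Hpr (T a) VTa)) as [Ax Bx]. apply T4; [assumption|assumption|].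
    rewrite Bx. unfold pr. rewrite OTa. vext. field. lra.
Qed.

(* [l] represents on the hyperplane orthogonal to [u] the linear form whose kernel is the
   hyperplane of revolution, which is thus the orthogonal complement of span(u, l). *)
Definition rev_data (n : nat) (N : pt -> R) (u : pt) (T : pt -> pt) (v l : pt) : Prop :=
  revolution n N u T v /\ vec (S n) l /\
  forall a, vec n a -> dot (S n) l (T a) = dot n v a.

(** Rotation about [e] moves every [y] in the kernel of [g] into the plane of [e] and [w], where [f]
    is known; the coefficients [s] and [t] are recovered from the height and length of [y]. *)
Lemma revolution_quadratic n (f : pt -> R) g e w :
  vec n g -> vec n e -> vec n w -> e <> vzero -> w <> vzero ->
  dot n g e = 0 -> dot n g w = 0 -> dot n e w = 0 ->
  (forall a b, vec n a -> vec n b -> dot n g a = 0 -> dot n g b = 0 ->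
     dot n e a ^ 2 = dot n e b ^ 2 -> dot n a a = dot n b b -> f a = f b) ->
  (forall s t, f (vadd (vscale s e) (vscale t w)) = s ^ 2 * f e + t ^ 2 * f w) ->
  forall y, vec n y -> dot n g y = 0 ->
    f y = f e * (dot n e y / dot n e e) ^ 2
          + f w / dot n w w * (dot n y y - dot n e y ^ 2 / dot n e e).
Proof.
  intros Vg Ve Vw He Hw Oge Ogw Oew Hrev Hq y Vy Ogy.
  assert (Pe := dot_self_pos _ _ Ve He). assert (Pw := dot_self_pos _ _ Vw Hw).
  set (s := dot n e y / dot n e e).
  assert (Hd : 0 <= (dot n y y - dot n e y ^ 2 / dot n e e) / dot n w w).
  { apply Rmult_le_pos; [|left; now apply Rinv_0_lt_compat].
    assert (P := dot_nonneg n (vsub y (vscale s e))). revert P. dots. rewrite (dot_sym n y e).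
    unfold s. intro P. replace (dot n y y - dot n e y ^ 2 / dot n e e) with
      (dot n y y - dot n e y / dot n e e * dot n e y -
       dot n e y / dot n e e * (dot n e y - dot n e y / dot n e e * dot n e e)) by (field; lra).
    lra. }
  set (t := sqrt ((dot n y y - dot n e y ^ 2 / dot n e e) / dot n w w)).
  assert (Ht : t ^ 2 = (dot n y y - dot n e y ^ 2 / dot n e e) / dot n w w) by (now apply pow2_sqrt).
  rewrite (Hrev y (vadd (vscale s e) (vscale t w))); auto with vec.
  - rewrite Hq, Ht. unfold s. field. lra.
  - dots. rewrite Oge, Ogw. ring.
  - dots. rewrite Oew. unfold s. field. lra.
  - dots. rewrite (dot_sym n w e), Oew.
    transitivity (s ^ 2 * dot n e e + t ^ 2 * dot n w w); [|ring].
    rewrite Ht. unfold s. field. lra.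
Qed.

(** Here [g] is [z] read in the coordinates [T], so the kernel of [g] parametrises the section;
    there the squared gauge is a quadratic form. *)
Lemma parallelogram_of_quadratic n N x z T g e al be :
  lin_iso_onto n T (hyperplane (S n) x) ->
  (forall a, vec n a -> dot n g a = dot (S n) z (T a)) ->
  (forall y, vec n y -> dot n g y = 0 -> N (T y) ^ 2 = al * dot n e y ^ 2 + be * dot n y y) ->
  parallelogram (S n) N x z.
Proof.
  intros HT Hg Hq a b Va Vb Oxa Oza Oxb Ozb.
  pose proof HT as [T1 [T2 [T3 [T4 T5]]]].
  destruct (T5 a (conj Va Oxa)) as [a0 [Va0 <-]].
  destruct (T5 b (conj Vb Oxb)) as [b0 [Vb0 <-]].
  rewrite <- Hg in Oza, Ozb by assumption.
  rewrite <- (lin_iso_sub n T _ a0 b0 HT), <- T2 by assumption.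
  rewrite !Hq by (auto with vec; dots; lra).
  dots. rewrite (dot_sym n b0 a0). ring.
Qed.

(** Changing the sign of [w] preserves height and length, so both diagonals of the parallelogram on
    [s v] and [t w] have the same gauge. *)
Lemma parallelogram_split n N x z T v w :
  revolution n N x T v -> (forall c p, vec (S n) p -> N (vscale c p) = Rabs c * N p) ->
  parallelogram (S n) N x z ->
  vec n w -> dot n v w = 0 -> dot (S n) z (T v) = 0 -> dot (S n) z (T w) = 0 ->
  forall s t, N (T (vadd (vscale s v) (vscale t w))) ^ 2 = s ^ 2 * N (T v) ^ 2 + t ^ 2 * N (T w) ^ 2.
Proof.
  intros [HT [Vv [_ Hrev]]] Gs Hp Vw Ovw Ozv Ozw s t.
  pose proof HT as [T1 [T2 [T3 _]]].
  destruct (T1 v Vv) as [V1 O1]. destruct (T1 w Vw) as [V2 O2].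
  assert (E : N (T (vsub (vscale s v) (vscale t w))) = N (T (vadd (vscale s v) (vscale t w)))).
  { apply Hrev; auto with vec; dots; rewrite ?(dot_sym n w v), Ovw; ring. }
  assert (H := Hp (vscale s (T v)) (vscale t (T w))).
  rewrite (lin_iso_sub n T _ (vscale s v) (vscale t w) HT), T2, !T3 in E by auto with vec.
  rewrite T2, !T3 by auto with vec.
  rewrite E, !Gs, !Rpow_mult_distr, !pow2_abs in H by assumption.
  lapply H; [clear H; intro H|auto with vec]. lapply H; [clear H; intro H|auto with vec].
  revert H. dots. rewrite O1, O2, Ozv, Ozw. intro H.
  specialize (H ltac:(ring) ltac:(ring) ltac:(ring) ltac:(ring)). lra.
Qed.

(** Within [u^perp], orthogonality to [a u + b l] means lying in the hyperplane of revolution, where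
    [N] is a multiple of the Euclidean length in coordinates. *)
Lemma revolution_plane_elliptic n N u T v l a b :
  (2 <= n)%nat -> (forall c p, vec (S n) p -> N (vscale c p) = Rabs c * N p) ->
  rev_data n N u T v l -> b <> 0 ->
  parallelogram (S n) N u (vadd (vscale a u) (vscale b l)).
Proof.
  intros Hn Gs [[HT [Vv [Hv Hrev]]] [Vl Hl]] Hb.
  pose proof HT as [T1 [T2 [T3 _]]].
  destruct (exists_orthogonal n (v :: nil)) as [w [Vw [Hw Ow]]]; [simpl; lia|].
  specialize (Ow v (or_introl eq_refl)). assert (Pw := dot_self_pos _ _ Vw Hw).
  apply (parallelogram_of_quadratic n N u _ T (vscale b v) v 0 (N (T w) ^ 2 / dot n w w)); auto.
  - intros c Vc. dots. rewrite Hl by assumption. destruct (T1 c Vc) as [_ ->]. ring.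
  - intros y Vy. dots. intro H. apply Rmult_integral in H. destruct H as [|Oy]; [contradiction|].
    assert (Hq : 0 <= dot n y y / dot n w w).
    { apply Rmult_le_pos; [apply dot_nonneg|left; now apply Rinv_0_lt_compat]. }
    rewrite (Hrev y (vscale (sqrt (dot n y y / dot n w w)) w)); auto with vec.
    + rewrite T3, Gs, Rpow_mult_distr, pow2_abs, pow2_sqrt by (try apply T1; assumption). field. lra.
    + dots. rewrite Oy, Ow. ring.
    + dots. replace (sqrt (dot n y y / dot n w w) * (sqrt (dot n y y / dot n w w) * dot n w w))
        with (sqrt (dot n y y / dot n w w) ^ 2 * dot n w w) by ring.
      rewrite pow2_sqrt by assumption. field. lra.
Qed.

(** As [n >= 3], the elliptic section contains, besides the axis, a direction [w] perpendicular to
    it in coordinates. The gauge is quadratic on their plane, and the revolution spreads this to the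
    whole hyperplane. *)
Lemma revolution_quadratic_of_axis n N u T v z :
  (3 <= n)%nat -> (forall c p, vec (S n) p -> N (vscale c p) = Rabs c * N p) ->
  revolution n N u T v -> dot (S n) z (T v) = 0 -> parallelogram (S n) N u z ->
  exists w, vec n w /\ w <> vzero /\
    forall y, vec n y -> N (T y) ^ 2 = N (T v) ^ 2 * (dot n v y / dot n v v) ^ 2
          + N (T w) ^ 2 / dot n w w * (dot n y y - dot n v y ^ 2 / dot n v v).
Proof.
  intros Hn Gs Hr Oz Hp. pose proof Hr as [HT [Vv [Hv Hrev]]].
  destruct (functional_pullback n T _ z HT) as [g [Vg Hg]].
  destruct (exists_orthogonal n (v :: g :: nil)) as [w [Vw [Hw Ow]]]; [simpl; lia|].
  assert (Ovw := Ow v (or_introl eq_refl)). assert (Ogw := Ow g (or_intror (or_introl eq_refl))).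
  rewrite Hg in Ogw by assumption.
  exists w. split; [assumption|]. split; [assumption|]. intros y Vy.
  apply (revolution_quadratic n (fun y => N (T y) ^ 2) vzero v w); auto with vec; try apply dot_zero_l.
  - intros a b Va Vb _ _ E1 E2. now rewrite (Hrev a b).
  - intros s t. now apply (parallelogram_split n N u z T v w).
Qed.

Lemma elliptic_of_elliptic_axis_section n N u T v z :
  (3 <= n)%nat -> (forall c p, vec (S n) p -> N (vscale c p) = Rabs c * N p) ->
  revolution n N u T v -> dot (S n) z (T v) = 0 -> parallelogram (S n) N u z ->
  parallelogram (S n) N u u.
Proof.
  intros Hn Gs Hr Oz Hp. pose proof Hr as [HT [Vv [Hv Hrev]]].
  destruct (revolution_quadratic_of_axis n N u T v z Hn Gs Hr Oz Hp) as [w [Vw [Hw Hq]]].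
  assert (Pv := dot_self_pos _ _ Vv Hv). assert (Pw := dot_self_pos _ _ Vw Hw).
  pose proof HT as [T1 _].
  apply (parallelogram_of_quadratic n N u u T vzero v
     (N (T v) ^ 2 / dot n v v ^ 2 - N (T w) ^ 2 / dot n w w / dot n v v) (N (T w) ^ 2 / dot n w w)); auto.
  - intros a Va. rewrite dot_zero_l. now destruct (T1 a Va) as [_ ->].
  - intros y Vy _. rewrite Hq by assumption. field. lra.
Qed.

(** * Two revolutions on a common section *)

Lemma exists_normalizing n x : vec n x -> x <> vzero ->
  exists c, 0 < c /\ dot n (vscale c x) (vscale c x) = 1.
Proof.
  intros Vx Hx. assert (P := dot_self_pos _ _ Vx Hx).
  assert (Q := sqrt_lt_R0 _ P).
  exists (/ sqrt (dot n x x)). split; [now apply Rinv_0_lt_compat|].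
  dots. rewrite <- (sqrt_sqrt (dot n x x)) at 3 by lra. field. lra.
Qed.

Lemma parallel_of_orthogonal m u z : vec m u -> u <> vzero -> vec m z ->
  (forall x, hyperplane m u x -> dot m z x = 0) -> exists k, z = vscale k u.
Proof.
  intros Vu Hu Vz H. assert (P := dot_self_pos _ _ Vu Hu).
  set (k := dot m u z / dot m u u). exists k.
  set (y := vsub z (vscale k u)).
  assert (Vy : vec m y) by (unfold y; auto with vec).
  assert (Oy : dot m u y = 0) by (unfold y; dots; unfold k; field; lra).
  assert (E : dot m y y = 0).
  { unfold y at 1. rewrite dot_sub_l, dot_scale_l, Oy, (H y (conj Vy Oy)). ring. }
  apply dot_self_eq0 in E; [|assumption]. vext. assert (E' := f_equal (fun f => f x) E).
  unfold y, vsub, vscale, vzero in E'. lra.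
Qed.

Lemma span3 a b c x : span (a :: b :: c :: nil) x ->
  exists k1 k2 k3, x = vadd (vscale k1 a) (vadd (vscale k2 b) (vscale k3 c)).
Proof.
  induction 1 as [|x k y _ [k1 [k2 [k3 ->]]] Hin].
  - exists 0, 0, 0. vext. ring.
  - destruct Hin as [<-|[<-|[<-|[]]]].
    + exists (k1 + k), k2, k3. vext. ring.
    + exists k1, (k2 + k), k3. vext. ring.
    + exists k1, k2, (k3 + k). vext. ring.
Qed.

(** Both revolutions restrict to a 3-space in the common section, spanned by the first restricted
    axis [e0], a vector [f0] in the first hyperplane of revolution only, and a vector [h0] in both.
    There [two_revolutions_quadratic] applies, and the first revolution extends the result to the
    whole section. *)
Lemma independent_revolutions_elliptic n B N x y Tx vx lx Ty vy ly :
  (4 <= n)%nat -> gauge (S n) B N ->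
  vec (S n) x -> x <> vzero -> vec (S n) y ->
  rev_data n N x Tx vx lx -> rev_data n N y Ty vy ly ->
  (forall al be ga de, vadd (vscale al lx) (vscale be ly) = vadd (vscale ga x) (vscale de y) ->
     al = 0 /\ be = 0) ->
  parallelogram (S n) N x y.
Proof.
  intros Hn HG Vx Hx Vy [[HTx [Vvx [Hvx Rx]]] [Vlx Hlx]] [[HTy [Vvy [Hvy Ry]]] [Vly Hly]] Hind.
  pose proof HTx as [X1 [X2 [X3 [X4 X5]]]]. pose proof HTy as [Y1 [Y2 [Y3 [Y4 Y5]]]].
  pose proof HG as [Gp [Gs [Gt [G0 _]]]].
  destruct (functional_pullback n Tx _ y HTx) as [g [Vg Hg]].
  (* [e0] is the part of [vx] orthogonal to [g], hence the axis inside the common section. If [g] is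
     zero, the value of [c] is immaterial. *)
  set (c := dot n vx g / dot n g g).
  set (e0 := vsub vx (vscale c g)).
  assert (Ve0 : vec n e0) by (unfold e0; auto with vec).
  assert (Oge : dot n g e0 = 0).
  { unfold e0. dots. destruct (classic (g = vzero)) as [->|Hg0].
    - rewrite !dot_zero_l. ring.
    - assert (P := dot_self_pos _ _ Vg Hg0). unfold c. rewrite (dot_sym n g vx). field. lra. }
  assert (He0 : e0 <> vzero).
  (* If [e0] vanished, [lx - c y] would vanish on [x^perp] and be a multiple of [x], against
     independence. *)
  { intro E. destruct (parallel_of_orthogonal (S n) x (vsub lx (vscale c y))) as [k Hk]; auto with vec.
    - intros z Hz. destruct (X5 z Hz) as [a [Va <-]]. dots. rewrite Hlx, <- Hg by assumption.
      assert (E' : dot n e0 a = 0) by (rewrite E; apply dot_zero_l).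
      revert E'. unfold e0. dots. lra.
    - destruct (Hind 1 0 k c) as [H _]; [|lra]. vext.
      assert (E' := f_equal (fun f => f x0) Hk). unfold vsub, vscale in E'. lra. }
  assert (Pe0 := dot_self_pos _ _ Ve0 He0).
  assert (Ove : dot n vx e0 = dot n e0 e0).
  { assert (dot n e0 e0 = dot n vx e0 - c * dot n g e0) by (unfold e0 at 1; dots; ring).
    rewrite Oge in H. lra. }
  assert (exists h0 h1, vec n h0 /\ vec n h1 /\ Tx h0 = Ty h1 /\ dot n h0 h0 = 1 /\
     dot n vx h0 = 0 /\ dot n vy h1 = 0 /\ dot n g h0 = 0) as [h0 [h1 [Vh0 [Vh1 [Eh [Nh [Oxh [Oyh Ogh]]]]]]]].
  { destruct (exists_orthogonal (S n) (x :: y :: lx :: ly :: nil)) as [h [Vh [Hh Oh]]]; [simpl; lia|].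
    cbn [In] in Oh.
    assert (O1 := Oh x ltac:(tauto)). assert (O2 := Oh y ltac:(tauto)).
    assert (O3 := Oh lx ltac:(tauto)). assert (O4 := Oh ly ltac:(tauto)).
    destruct (X5 h (conj Vh O1)) as [h0 [Vh0 E0]]. destruct (Y5 h (conj Vh O2)) as [h1 [Vh1 E1]].
    destruct (exists_normalizing n h0 Vh0) as [k [Hk Nk]].
    { intros ->. apply Hh. rewrite <- E0. now apply (lin_iso_zero n Tx (hyperplane (S n) x)). }
    exists (vscale k h0), (vscale k h1).
    rewrite X3, Y3 by assumption.
    repeat split; auto with vec.
    - now rewrite E0, E1.
    - rewrite dot_scale_r, <- Hlx, E0, O3 by assumption. ring.
    - rewrite dot_scale_r, <- Hly, E1, O4 by assumption. ring.
    - rewrite dot_scale_r, Hg, E0, O2 by assumption. ring. }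
  assert (exists f0 f1, vec n f0 /\ vec n f1 /\ Tx f0 = Ty f1 /\ dot n f0 f0 = 1 /\ dot n h0 f0 = 0 /\
     dot n vx f0 = 0 /\ dot n vy f1 <> 0 /\ dot n g f0 = 0)
     as [f0 [f1 [Vf0 [Vf1 [Ef [Nf [Ohf [Oxf [Oyf Ogf]]]]]]]]].
  { destruct (exists_separating (S n) (x :: y :: lx :: nil) ly) as [f [Vf [Of Hf]]]; auto.
    - simpl. intros a [<-|[<-|[<-|[]]]]; assumption.
    - intro Hs. apply span3 in Hs. destruct Hs as [k1 [k2 [k3 E]]].
      destruct (Hind (- k3) 1 k1 k2) as [_ H]; [|lra]. rewrite E. vext. ring.
    - cbn [In] in Of. assert (O1 := Of x ltac:(tauto)). assert (O2 := Of y ltac:(tauto)).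
      assert (O3 := Of lx ltac:(tauto)).
      destruct (X5 f (conj Vf O1)) as [f0 [Vf0 E0]]. destruct (Y5 f (conj Vf O2)) as [f1 [Vf1 E1]].
      (* Removing the [h]-component makes the frame orthogonal and leaves the value of [ly]
         unchanged, since [ly] kills [h]. *)
      set (d := dot n h0 f0).
      assert (Hv : dot n vy (vsub f1 (vscale d h1)) = dot (S n) ly f).
      { dots. rewrite Oyh, <- Hly, E1 by assumption. ring. }
      assert (ET : Tx (vsub f0 (vscale d h0)) = Ty (vsub f1 (vscale d h1))).
      { rewrite (lin_iso_sub _ _ _ _ _ HTx), (lin_iso_sub _ _ _ _ _ HTy), X3, Y3 by auto with vec.
        now rewrite Eh, E0, E1. }
      destruct (exists_normalizing n (vsub f0 (vscale d h0))) as [k [Hk Nk]]; [auto with vec| |].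
      { intro E. apply Hf. rewrite <- Hv, <- Hly, <- ET, E by auto with vec.
        rewrite (lin_iso_zero n Tx _ HTx). apply dot_zero_r. }
      exists (vscale k (vsub f0 (vscale d h0))), (vscale k (vsub f1 (vscale d h1))).
      repeat split; auto with vec.
      + rewrite X3, Y3, ET by auto with vec. reflexivity.
      + dots. rewrite Nh. unfold d. ring.
      + dots. rewrite Oxh, <- Hlx, E0, O3 by assumption. ring.
      + rewrite dot_scale_r, Hv. apply Rmult_integral_contrapositive_currified; [lra|assumption].
      + dots. rewrite Ogh, Hg, E0, O2 by assumption. ring. }
  assert (Hey : hyperplane (S n) y (Tx e0)).
  { split; [now apply X1|]. now rewrite <- Hg. }
  destruct (Y5 _ Hey) as [e1 [Ve1 Ee]]. symmetry in Ee.
  assert (Oef : dot n e0 f0 = 0) by (unfold e0; dots; rewrite Oxf, Ogf; ring).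
  assert (Oeh : dot n e0 h0 = 0) by (unfold e0; dots; rewrite Oxh, Ogh; ring).
  set (cx := fun t w s => vadd (vscale t e0) (vadd (vscale w f0) (vscale s h0))).
  set (cy := fun t w s => vadd (vscale t e1) (vadd (vscale w f1) (vscale s h1))).
  assert (Vcx : forall t w s, vec n (cx t w s)) by (intros; unfold cx; auto with vec).
  assert (Vcy : forall t w s, vec n (cy t w s)) by (intros; unfold cy; auto with vec).
  assert (Tc : forall t w s, Tx (cx t w s) =
     vadd (vscale t (Tx e0)) (vadd (vscale w (Tx f0)) (vscale s (Tx h0)))).
  { intros. unfold cx. rewrite !X2, !X3 by auto with vec. reflexivity. }
  assert (Txy : forall t w s, Tx (cx t w s) = Ty (cy t w s)).
  { intros. rewrite Tc. unfold cy. rewrite !Y2, !Y3 by auto with vec. now rewrite Ee, Ef, Eh. }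
  assert (VTe := proj1 (X1 e0 Ve0)). assert (VTf := proj1 (X1 f0 Vf0)). assert (VTh := proj1 (X1 h0 Vh0)).
  set (k := dot n vy f1) in *. set (a := dot n vy e1 / k).
  assert (Ncx : forall t w s, dot n (cx t w s) (cx t w s) = t ^ 2 * dot n e0 e0 + w ^ 2 + s ^ 2).
  { intros. unfold cx. dots. rewrite (dot_sym n f0 e0), (dot_sym n h0 e0), (dot_sym n f0 h0),
      Oef, Oeh, Ohf, Nf, Nh. ring. }
  (* [a] is chosen so that [vy] kills [ea]. In the basis [ea], [f1], [h1] the coordinates are
     [(t, w + a t, s)], and the Gram matrix supplies the coefficients of [q]. *)
  set (ea := vsub e1 (vscale a f1)).
  assert (Hea : ea <> vzero).
  { intro E. assert (e0 = vscale a f0).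
    { apply X4; auto with vec. rewrite X3, Ee, Ef, <- Y3 by assumption. f_equal.
      vext. assert (E' := f_equal (fun f => f x0) E). unfold ea, vsub, vscale, vzero in E'. lra. }
    assert (dot n e0 e0 = 0); [|lra]. rewrite H at 2. dots. rewrite Oef. ring. }
  destruct (two_revolutions_quadratic (fun t w s => N (Tx (cx t w s))) a
     (dot n ea ea) (dot n f1 f1) (dot n h1 h1) (dot n ea f1) (dot n ea h1) (dot n f1 h1))
     as [al [be Hq]].
  - intros d t w s. rewrite <- Gs by (apply X1; auto). rewrite <- X3 by auto. f_equal. f_equal.
    unfold cx. vext. ring.
  - intro t. destruct (Gp (Tx (cx t 1 0)) (proj1 (X1 _ (Vcx t 1 0)))) as [|E]; [assumption|exfalso].
    symmetry in E. apply G0 in E; [|now apply X1]. apply (lin_iso_eq0 n Tx _ _ HTx) in E; [|auto].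
    assert (H := Ncx t 1 0). rewrite E, dot_zero_l in H. nra.
  - assert (Hc := gauge_continuity (S n) B N (Tx f0) (Tx e0) HG VTf VTe).
    replace (fun t => N (Tx (cx t 1 0))) with (fun t => N (vadd (Tx f0) (vscale t (Tx e0)))); [assumption|].
    apply functional_extensionality. intro t. rewrite Tc. f_equal. vext. ring.
  - intro t. assert (Hc := gauge_continuity (S n) B N (vscale t (Tx e0)) (Tx f0) HG ltac:(auto with vec) VTf).
    replace (fun w => N (Tx (cx t w 0))) with (fun w => N (vadd (vscale t (Tx e0)) (vscale w (Tx f0))));
      [assumption|].
    apply functional_extensionality. intro w. rewrite Tc. f_equal. vext. ring.
  - intros t w s t' w' s' E1 E2. apply Rx; auto.
    + unfold cx. dots. rewrite Oxf, Oxh, Ove.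
      replace ((t * dot n e0 e0 + (w * 0 + s * 0)) ^ 2) with (t ^ 2 * dot n e0 e0 ^ 2) by ring.
      rewrite E1. ring.
    + rewrite !Ncx, E1. lra.
  - cbv beta zeta. intros t w s t' w' s' E1 E2. rewrite !Txy.
    assert (Hdec : forall t w s, cy t w s = vadd (vscale t ea) (vadd (vscale (w + a * t) f1) (vscale s h1))).
    { intros. unfold cy, ea. vext. ring. }
    apply Ry; auto.
    + assert (Hv : forall t w s, dot n vy (cy t w s) = k * (w + a * t)).
      { intros. unfold cy. dots. rewrite Oyh. fold k. unfold a. field. assumption. }
      rewrite !Hv, !Rpow_mult_distr. f_equal. assumption.
    + rewrite !Hdec. dots. rewrite (dot_sym n f1 ea), (dot_sym n h1 ea), (dot_sym n h1 f1). lra.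
  - apply dot_self_pos; [unfold ea; auto with vec|assumption].
  - apply dot_self_pos; [assumption|]. intros ->. rewrite (lin_iso_zero n Ty _ HTy) in Eh.
    apply (lin_iso_eq0 n Tx _ _ HTx) in Eh; [|assumption]. rewrite Eh, dot_zero_l in Nh. lra.
  - intros t s. cbv beta zeta. assert (P := dot_nonneg n (vadd (vscale t ea) (vscale s h1))).
    revert P. dots. rewrite (dot_sym n h1 ea). lra.
  - assert (Q1 : N (Tx e0) ^ 2 = al).
    { assert (H := Hq 1 0 0). cbv beta in H. replace (cx 1 0 0) with e0 in H by (unfold cx; vext; ring). lra. }
    assert (Q2 : N (Tx f0) ^ 2 = be).
    { assert (H := Hq 0 1 0). cbv beta in H. replace (cx 0 1 0) with f0 in H by (unfold cx; vext; ring). lra. }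
    apply (parallelogram_of_quadratic n N x y Tx g e0
      (al / dot n e0 e0 ^ 2 - be / dot n e0 e0) be HTx Hg).
    intros z Vz Oz.
    rewrite (revolution_quadratic n (fun z => N (Tx z) ^ 2) g e0 f0); auto.
    + rewrite Q1, Q2, Nf. field. lra.
    + intros ->. rewrite dot_zero_l in Nf. lra.
    + intros p q Vp Vq Op Oq E1 E2. rewrite (Rx p q); auto.
      (* Heights along [vx] and [e0] agree on the section, as the two vectors differ by a multiple
         of [g]. *)
      assert (Hve : forall p, dot n g p = 0 -> dot n vx p = dot n e0 p).
      { intros r Or. unfold e0. dots. rewrite Or. ring. }
      now rewrite !Hve.
    + intros s t. rewrite Q1, Q2.
      assert (H := Hq s t 0). cbv beta in H.
      replace (cx s t 0) with (vadd (vscale s e0) (vscale t f0)) in H by (unfold cx; vext; ring). lra.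
Qed.

(** Rearranged, the relation says that [al lx - ga x = de y - be ly] lies in both planes [P_x] and
    [P_y]. *)
Lemma nonelliptic_planes_meet n B N x y Tx vx lx Ty vy ly :
  (4 <= n)%nat -> gauge (S n) B N ->
  vec (S n) x -> x <> vzero -> vec (S n) y ->
  rev_data n N x Tx vx lx -> rev_data n N y Ty vy ly ->
  ~ parallelogram (S n) N x y ->
  exists al be ga de, vadd (vscale al lx) (vscale be ly) = vadd (vscale ga x) (vscale de y) /\
     (al <> 0 \/ be <> 0).
Proof.
  intros Hn HG Vx Hx Vy Dx Dy Hp. apply NNPP. intro H. apply Hp.
  apply (independent_revolutions_elliptic n B N x y Tx vx lx Ty vy ly); auto.
  intros al be ga de E. apply NNPP. intro H'. apply H. exists al, be, ga, de. split; [assumption|].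
  destruct (Req_dec al 0), (Req_dec be 0); tauto.
Qed.

(** * Perturbing non-elliptic sections *)

Lemma nonelliptic_open m B N x z k :
  gauge m B N -> vec m x -> x <> vzero -> vec m z -> vec m k ->
  ~ parallelogram m N x z -> (forall c, z <> vscale c x) ->
  dot m k x = 0 -> dot m k z = 0 ->
  exists e0, 0 < e0 /\ forall e, 0 < e < e0 -> ~ parallelogram m N x (vadd z (vscale e k)).
Proof.
  intros HG Vx Hx Vz Vk Hp Hz Okx Okz.
  assert (Px := dot_self_pos _ _ Vx Hx).
  assert (exists a b, vec m a /\ vec m b /\ dot m x a = 0 /\ dot m z a = 0 /\ dot m x b = 0 /\
     dot m z b = 0 /\ N (vadd a b) ^ 2 + N (vsub a b) ^ 2 - (2 * N a ^ 2 + 2 * N b ^ 2) <> 0)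
     as [a [b [Va [Vb [Oxa [Oza [Oxb [Ozb Hab]]]]]]]].
  { apply NNPP. intro H. apply Hp. intros a b **. apply NNPP. intro H'. apply H.
    exists a, b. repeat split; auto. intro. apply H'. lra. }
  set (w := vsub z (vscale (dot m x z / dot m x x) x)).
  assert (Vw : vec m w) by (unfold w; auto with vec).
  assert (Hw : w <> vzero).
  { intro E. apply (Hz (dot m x z / dot m x x)). vext. assert (E' := f_equal (fun f => f x0) E).
    unfold w, vsub, vscale, vzero in E'. lra. }
  assert (Pw := dot_self_pos _ _ Vw Hw).
  assert (Oxw : dot m x w = 0) by (unfold w; dots; field; lra).
  assert (Ozw : dot m z w = dot m w w).
  { assert (dot m w w = dot m z w - dot m x z / dot m x x * dot m x w) by (unfold w at 1; dots; ring).
    rewrite Oxw in H. lra. }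
  assert (Okw : dot m k w = 0) by (unfold w; dots; rewrite Okx, Okz; ring).
  (* Corrections along [w], the part of [z] orthogonal to [x], keep the failing pair [a], [b] in the
     moving section: [a + e ra] is orthogonal to [x] and to [z + e k]. The defect [D] then varies
     continuously with [e]. *)
  set (ra := vscale (- dot m k a / dot m w w) w). set (rb := vscale (- dot m k b / dot m w w) w).
  assert (Vra : vec m ra) by (unfold ra; auto with vec).
  assert (Vrb : vec m rb) by (unfold rb; auto with vec).
  set (D := fun e => N (vadd (vadd a b) (vscale e (vadd ra rb))) ^ 2
      + N (vadd (vsub a b) (vscale e (vsub ra rb))) ^ 2
      - (2 * N (vadd a (vscale e ra)) ^ 2 + 2 * N (vadd b (vscale e rb)) ^ 2)).
  assert (CD : continuity D).
  { assert (Hsq : forall p q, vec m p -> vec m q -> continuity (fun e => N (vadd p (vscale e q)) ^ 2)).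
    { intros p q Vp Vq. apply (continuity_comp (fun e => N (vadd p (vscale e q))) (fun y => y ^ 2)).
      - now apply (gauge_continuity m B).
      - intro. reg. }
    unfold D. apply continuity_minus; apply continuity_plus; try apply Hsq; auto with vec.
    - apply (continuity_scal (fun e => N (vadd a (vscale e ra)) ^ 2)). now apply Hsq.
    - apply (continuity_scal (fun e => N (vadd b (vscale e rb)) ^ 2)). now apply Hsq. }
  assert (D0 : D 0 <> 0).
  { unfold D. replace (vadd (vadd a b) (vscale 0 (vadd ra rb))) with (vadd a b) by (vext; ring).
    replace (vadd (vsub a b) (vscale 0 (vsub ra rb))) with (vsub a b) by (vext; ring).
    replace (vadd a (vscale 0 ra)) with a by (vext; ring).
    replace (vadd b (vscale 0 rb)) with b by (vext; ring). assumption. }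
  destruct (continuity_pt_pos_near (fun e => D e * D e) 0) as [e0 [He0 Hn]].
  { apply continuity_pt_mult; apply CD. }
  { nra. }
  exists e0. split; [assumption|]. intros e He Hpar.
  specialize (Hn e ltac:(apply Rabs_def1; lra)). simpl in Hn.
  assert (D e = 0); [|rewrite H in Hn; lra].
  assert (H := Hpar (vadd a (vscale e ra)) (vadd b (vscale e rb))).
  unfold D. replace (vadd (vadd a b) (vscale e (vadd ra rb))) with
    (vadd (vadd a (vscale e ra)) (vadd b (vscale e rb))) by (vext; ring).
  replace (vadd (vsub a b) (vscale e (vsub ra rb))) with
    (vsub (vadd a (vscale e ra)) (vadd b (vscale e rb))) by (vext; ring).
  rewrite H; auto with vec; [ring| | | |]; unfold ra, rb; dots; rewrite ?Oxa, ?Oxb, ?Oza, ?Ozb, ?Oxw, ?Ozw, ?Okw;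
    field; lra.
Qed.

(** As [d1] and [d2] are independent, the affine line [d1 + t d2] meets the line spanned by [x] for
    at most one [t]; that parameter serves as [M]. *)
Lemma eventually_not_parallel x d1 d2 :
  (forall c, d2 <> vscale c d1) -> d1 <> vzero ->
  exists M, forall t, M < t -> forall c, vadd d1 (vscale t d2) <> vscale c x.
Proof.
  intros H12 H1.
  destruct (classic (exists t c, vadd d1 (vscale t d2) = vscale c x)) as [[t0 [c0 E0]]|Hn].
  - exists t0. intros t Ht c E.
    assert (H : forall i, (c - c0) * d1 i = (c0 * t - c * t0) * d2 i).
    { intro i. assert (A := f_equal (fun f => f i) E0). assert (B := f_equal (fun f => f i) E).
      unfold vadd, vscale in A, B.
      assert (c * (d1 i + t0 * d2 i) = c0 * (d1 i + t * d2 i)) by (rewrite A, B; ring). lra. }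
    destruct (Req_dec (c0 * t - c * t0) 0) as [Z|Z].
    + assert (c = c0 \/ c <> c0) as [Ec|Ec] by apply classic.
      * subst. assert (c0 = 0) by nra. subst. assert (t = t0); [|lra].
        exfalso. apply (H12 0). vext.
        assert (A := f_equal (fun f => f x0) E0). assert (B := f_equal (fun f => f x0) E).
        unfold vadd, vscale in A, B. nra.
      * apply H1. vext. specialize (H x0). rewrite Z in H.
        assert ((c - c0) * d1 x0 = 0) by lra. apply Rmult_integral in H0. destruct H0; [lra|assumption].
    + apply (H12 ((c - c0) / (c0 * t - c * t0))). vext.
      apply Rmult_eq_reg_l with (c0 * t - c * t0); [|assumption]. rewrite <- H. field. assumption.
  - exists 0. intros t _ c E. apply Hn. now exists t, c.
Qed.

(** * From the parallelogram law to an ellipsoid *)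

Lemma parallelogram_ellipsoid n B N u T v :
  (3 <= n)%nat -> gauge (S n) B N -> revolution n N u T v -> parallelogram (S n) N u u ->
  ellipsoid n (hyperplane (S n) u) (section B (hyperplane (S n) u)).
Proof.
  intros Hn HG Hr Hp. pose proof Hr as [HT [Vv [Hv Hrev]]].
  pose proof HT as [T1 [T2 [T3 [T4 T5]]]]. pose proof HG as [Gp [Gs [_ [G0 GB]]]].
  destruct (revolution_quadratic_of_axis n N u T v u Hn Gs Hr (proj2 (T1 v Vv)) Hp) as [w [Vw [Hw Hq]]].
  assert (Pv := dot_self_pos _ _ Vv Hv). assert (Pw := dot_self_pos _ _ Vw Hw).
  assert (PN : forall y, vec n y -> y <> vzero -> 0 < N (T y)).
  { intros y Vy Hy. destruct (Gp (T y) (proj1 (T1 y Vy))) as [|E]; [assumption|]. exfalso. apply Hy.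
    apply (lin_iso_eq0 n T _ _ HT); [assumption|]. apply G0; [now apply T1|now symmetry]. }
  assert (P1 := PN v Vv Hv). assert (P2 := PN w Vw Hw).
  (* The ratios of Euclidean length to gauge across and along the axis; rescaling by them turns the
     gauge into the Euclidean norm. *)
  set (p := sqrt (dot n w w) / N (T w)). set (r := sqrt (dot n v v) / N (T v)).
  assert (Hp0 : 0 < p) by (apply Rdiv_lt_0_compat; [now apply sqrt_lt_R0|assumption]).
  assert (Hr0 : 0 < r) by (apply Rdiv_lt_0_compat; [now apply sqrt_lt_R0|assumption]).
  assert (Ep : p ^ 2 = dot n w w / N (T w) ^ 2).
  { unfold p. unfold Rdiv. rewrite Rpow_mult_distr, pow2_sqrt by lra. field. lra. }
  assert (Er : r ^ 2 = dot n v v / N (T v) ^ 2).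
  { unfold r. unfold Rdiv. rewrite Rpow_mult_distr, pow2_sqrt by lra. field. lra. }
  (* [S] has eigenvalue [r] on the axis and [p] on its orthogonal complement. *)
  set (S := fun y => vadd (vscale p y) (vscale ((r - p) * dot n v y / dot n v v) v)).
  assert (VS : forall y, vec n y -> vec n (S y)) by (intros; unfold S; auto with vec).
  assert (ES : forall y, vec n y -> N (T (S y)) ^ 2 = dot n y y).
  { intros y Vy. rewrite Hq by auto.
    assert (H1 : dot n v (S y) = r * dot n v y) by (unfold S; dots; field; lra).
    assert (H2 : dot n (S y) (S y) = p ^ 2 * dot n y y + (r ^ 2 - p ^ 2) * dot n v y ^ 2 / dot n v v).
    { unfold S. dots. rewrite (dot_sym n y v). field. lra. }
    rewrite H1, H2.
    replace (N (T v) ^ 2 * (r * dot n v y / dot n v v) ^ 2)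
      with (N (T v) ^ 2 * r ^ 2 * dot n v y ^ 2 / dot n v v ^ 2) by (field; lra).
    replace ((r * dot n v y) ^ 2) with (r ^ 2 * dot n v y ^ 2) by ring.
    rewrite Ep, Er. field. lra. }
  assert (Ssurj : forall y, vec n y -> exists y', vec n y' /\ S y' = y).
  { intros y Vy. exists (vadd (vscale (/ p) y) (vscale ((/ r - / p) * dot n v y / dot n v v) v)).
    split; [auto with vec|]. unfold S. dots. vext. field. lra. }
  assert (HI : lin_iso_onto n (fun y => T (S y)) (hyperplane (Datatypes.S n) u)).
  { repeat split.
    - now apply T1, VS.
    - now apply T1, VS.
    - intros x y Vx Vy. rewrite <- T2 by auto. f_equal. unfold S. dots. vext. field. lra.
    - intros a x Vx. rewrite <- T3 by auto. f_equal. unfold S. dots. vext. field. lra.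
    - intros x y Vx Vy E. apply T4 in E; auto.
      assert (Z : dot n (vsub x y) (vsub x y) = 0).
      { rewrite <- ES by auto with vec.
        replace (S (vsub x y)) with (vsub (S x) (S y)) by (unfold S; dots; vext; field; lra).
        rewrite E. replace (vsub (S y) (S y)) with vzero by (vext; ring).
        rewrite (lin_iso_zero n T _ HT). replace vzero with (vscale 0 vzero) by (vext; ring).
        rewrite Gs, Rabs_R0 by apply vec_zero. ring. }
      apply dot_self_eq0 in Z; [|auto with vec]. vext. assert (E' := f_equal (fun f => f x0) Z).
      unfold vsub, vzero in E'. lra.
    - intros z Hz. destruct (T5 z Hz) as [y [Vy <-]]. destruct (Ssurj y Vy) as [y' [Vy' <-]]. now exists y'. }
  exists (fun y => T (S y)), vzero. split; [assumption|]. split.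
  { split; [apply vec_zero|apply dot_zero_r]. }
  assert (Hb : forall y, vec n y -> (B (T (S y)) <-> norm n y <= 1)).
  { intros y Vy. rewrite GB by (apply T1; auto). unfold norm. rewrite <- ES by assumption.
    rewrite sqrt_pow2; [tauto|]. apply Gp, T1. auto. }
  intro z. split.
  - intros [Bz Hz]. destruct (T5 z Hz) as [y [Vy <-]]. destruct (Ssurj y Vy) as [y' [Vy' <-]].
    exists y'. split; [assumption|]. split; [now apply Hb|]. vext. ring.
  - intros [y [Vy [Ny ->]]]. replace (vadd vzero (T (S y))) with (T (S y)) by (vext; ring).
    split; [now apply Hb|]. apply T1. auto.
Qed.

(** * Incidence of the planes of revolution *)

Lemma rev_data_not_parallel n N u T v l c : rev_data n N u T v l -> l <> vscale c u.
Proof.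
  intros [[[T1 _] [Vv [Hv _]]] [_ Hl]] E.
  (* The axis [T v] pairs positively with [l] but is orthogonal to [u]. *)
  assert (P := dot_self_pos _ _ Vv Hv). rewrite <- Hl, E, dot_scale_l in P by assumption.
  rewrite (proj2 (T1 v Vv)) in P. lra.
Qed.

Lemma no_elliptic_section_absurd n B N :
  (4 <= n)%nat -> gauge (S n) B N ->
  (forall u, vec (S n) u -> u <> vzero -> exists T v l, rev_data n N u T v l) ->
  ~ (forall u, vec (S n) u -> u <> vzero -> ~ parallelogram (S n) N u u).
Proof.
  intros Hn HG HD Hno. pose proof HG as [_ [Gs _]].
  assert (Hax : forall u T v l z, vec (S n) u -> u <> vzero -> rev_data n N u T v l ->
     dot (S n) (T v) z = 0 -> ~ parallelogram (S n) N u z).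
  { intros u T v l z Vu Hu [Hr _] Oz Hp. apply (Hno u Vu Hu).
    apply (elliptic_of_elliptic_axis_section n N u T v z); auto; [lia|]. now rewrite dot_sym. }
  destruct (exists_orthogonal (S n) nil) as [x [Vx [Hx _]]]; [simpl; lia|].
  destruct (HD x Vx Hx) as [Tx [vx [lx Dx]]].
  destruct (exists_orthogonal (S n) (x :: Tx vx :: nil)) as [y [Vy [Hy Oy]]]; [simpl; lia|].
  assert (Oxy := Oy x (or_introl eq_refl)). assert (Oay := Oy (Tx vx) (or_intror (or_introl eq_refl))).
  clear Oy.
  assert (Nxy := Hax x Tx vx lx y Vx Hx Dx Oay).
  destruct (HD y Vy Hy) as [Ty [vy [ly Dy]]].
  pose proof Dx as [_ [Vlx _]]. pose proof Dy as [_ [Vly _]].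
  (* [y] is not in [P_x]: otherwise it would be a multiple of [x], or the common section would be
     the elliptic hyperplane of revolution. *)
  assert (Hyx : forall a b, y <> vadd (vscale a x) (vscale b lx)).
  { intros a b E. destruct (Req_dec b 0) as [->|Hb].
    - assert (P := dot_self_pos _ _ Vy Hy). rewrite E in P at 1. revert P. dots. rewrite Oxy. lra.
    - apply Nxy. rewrite E. apply (revolution_plane_elliptic n N x Tx vx); auto. lia. }
  destruct (nonelliptic_planes_meet n B N x y Tx vx lx Ty vy ly Hn HG Vx Hx Vy Dx Dy Nxy)
    as [al [be [ga [de [Ep Hab]]]]].
  assert (Ep' : forall i, al * lx i + be * ly i = ga * x i + de * y i).
  { intro i. exact (f_equal (fun f => f i) Ep). }
  assert (Hbe : be <> 0).
  { intro Z. destruct Hab as [Ha|]; [|contradiction]. destruct (Req_dec de 0) as [Zd|Hd].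
    - apply (rev_data_not_parallel n N x Tx vx lx (ga / al) Dx). vext. specialize (Ep' x0). rewrite Z, Zd in Ep'.
      apply Rmult_eq_reg_l with al; [|assumption]. replace (al * (ga / al * x x0)) with (ga * x x0) by (field; assumption). lra.
    - apply (Hyx (- ga / de) (al / de)). vext. specialize (Ep' x0). rewrite Z in Ep'.
      apply Rmult_eq_reg_l with de; [|assumption].
      replace (de * (- ga / de * x x0 + al / de * lx x0)) with (- ga * x x0 + al * lx x0) by (field; assumption).
      lra. }
  set (p := vsub (vscale de y) (vscale be ly)).
  assert (Epx : p = vsub (vscale al lx) (vscale ga x)).
  { unfold p. vext. specialize (Ep' x0). lra. }
  assert (Vp : vec (S n) p) by (unfold p; auto with vec).
  assert (Hp : p <> vzero).
  { intro Z. apply (rev_data_not_parallel n N y Ty vy ly (de / be) Dy). vext.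
    assert (Z' := f_equal (fun f => f x0) Z). unfold p, vsub, vscale, vzero in Z'.
    apply Rmult_eq_reg_l with be; [|assumption].
    replace (be * (de / be * y x0)) with (de * y x0) by (field; assumption). lra. }
  destruct (HD p Vp Hp) as [Tp [vp [lp Dp]]].
  (* [k] is orthogonal to [P_x + P_y]; orthogonality to [ly] follows through [p] because [be] is
     nonzero. A nonzero product with [k] will keep [z] outside this 3-space. *)
  destruct (exists_orthogonal (S n) (x :: lx :: y :: nil)) as [k [Vk [Hk Ok]]]; [simpl; lia|].
  cbn [In] in Ok. assert (Oxk := Ok x ltac:(tauto)). assert (Olk := Ok lx ltac:(tauto)).
  assert (Oyk := Ok y ltac:(tauto)). clear Ok. assert (Pk := dot_self_pos _ _ Vk Hk).
  assert (Opk : dot (S n) p k = 0) by (rewrite Epx; dots; rewrite Olk, Oxk; ring).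
  assert (Olyk : dot (S n) ly k = 0).
  { revert Opk. unfold p. dots. rewrite Oyk. intro H. apply Rmult_eq_reg_l with be; [lra|assumption]. }
  assert (exists z, vec (S n) z /\ dot (S n) k z <> 0 /\ ~ parallelogram (S n) N x z /\
     ~ parallelogram (S n) N y z /\ ~ parallelogram (S n) N p z) as [z [Vz [Okz [Nx [Ny Np]]]]].
  (* In dimension at least 5, two independent directions are orthogonal to all three axes, so [z]
     can avoid the lines of [x], [y] and [p]. If [z] is still orthogonal to [k], a small tilt along
     [k] preserves non-ellipticity. *)
  { destruct (exists_orthogonal (S n) (Tx vx :: Ty vy :: Tp vp :: nil)) as [d1 [Vd1 [Hd1 O1]]]; [simpl; lia|].
    destruct (exists_orthogonal (S n) (Tx vx :: Ty vy :: Tp vp :: d1 :: nil)) as [d2 [Vd2 [Hd2 O2]]]; [simpl; lia|].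
    assert (H12 : forall c, d2 <> vscale c d1).
    { intros c E. assert (P := dot_self_pos _ _ Vd2 Hd2). rewrite E in P at 1.
      rewrite dot_scale_l, (O2 d1) in P by (cbn; tauto). lra. }
    destruct (eventually_not_parallel x d1 d2 H12 Hd1) as [M1 HM1].
    destruct (eventually_not_parallel y d1 d2 H12 Hd1) as [M2 HM2].
    destruct (eventually_not_parallel p d1 d2 H12 Hd1) as [M3 HM3].
    set (t := Rmax M1 (Rmax M2 M3) + 1).
    pose proof (Rmax_l M1 (Rmax M2 M3)). pose proof (Rmax_r M1 (Rmax M2 M3)).
    pose proof (Rmax_l M2 M3). pose proof (Rmax_r M2 M3).
    specialize (HM1 t ltac:(unfold t; lra)). specialize (HM2 t ltac:(unfold t; lra)).
    specialize (HM3 t ltac:(unfold t; lra)).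
    set (z := vadd d1 (vscale t d2)) in *.
    assert (Vz : vec (S n) z) by (unfold z; auto with vec).
    assert (Oz : forall a, In a (Tx vx :: Ty vy :: Tp vp :: nil) -> dot (S n) a z = 0).
    { intros a Ha. unfold z. dots. rewrite O1, O2 by (cbn in *; tauto). ring. }
    assert (Nx := Hax x Tx vx lx z Vx Hx Dx (Oz (Tx vx) ltac:(cbn; tauto))).
    assert (Ny := Hax y Ty vy ly z Vy Hy Dy (Oz (Ty vy) ltac:(cbn; tauto))).
    assert (Np := Hax p Tp vp lp z Vp Hp Dp (Oz (Tp vp) ltac:(cbn; tauto))).
    destruct (Req_dec (dot (S n) k z) 0) as [Zk|]; [|now exists z].
    destruct (nonelliptic_open (S n) B N x z k HG Vx Hx Vz Vk Nx HM1) as [e1 [He1 Q1]];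
      [now rewrite dot_sym|assumption|].
    destruct (nonelliptic_open (S n) B N y z k HG Vy Hy Vz Vk Ny HM2) as [e2 [He2 Q2]];
      [now rewrite dot_sym|assumption|].
    destruct (nonelliptic_open (S n) B N p z k HG Vp Hp Vz Vk Np HM3) as [e3 [He3 Q3]];
      [now rewrite dot_sym|assumption|].
    set (e := Rmin e1 (Rmin e2 e3) / 2).
    pose proof (Rmin_l e1 (Rmin e2 e3)). pose proof (Rmin_r e1 (Rmin e2 e3)).
    pose proof (Rmin_l e2 e3). pose proof (Rmin_r e2 e3).
    assert (0 < Rmin e1 (Rmin e2 e3)) by (repeat apply Rmin_pos; assumption).
    exists (vadd z (vscale e k)). split; [auto with vec|]. split.
    { dots. rewrite Zk. assert (0 < e) by (unfold e; lra). nra. }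
    split; [apply Q1|split; [apply Q2|apply Q3]]; unfold e; lra. }
  assert (Hz : z <> vzero) by (intros ->; apply Okz, dot_zero_r).
  destruct (HD z Vz Hz) as [Tz [vz [lz Dz]]].
  (* The span of [z] and [lz] is not contained in [k]'s orthogonal complement, so it meets it
     in the single line spanned by [q]. *)
  set (rho := dot (S n) k lz / dot (S n) k z).
  set (q := vsub lz (vscale rho z)).
  (* A common vector of [P_u] and [P_z] is orthogonal to [k], so it is a multiple of [q]. *)
  assert (Hmeet : forall u lu Tu vu, vec (S n) u -> u <> vzero -> rev_data n N u Tu vu lu ->
     dot (S n) u k = 0 -> dot (S n) lu k = 0 -> ~ parallelogram (S n) N u z ->
     exists a b, q = vadd (vscale a u) (vscale b lu)).
  { intros u lu Tu vu Vu Hu Du Ouk Oluk Nu.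
    destruct (nonelliptic_planes_meet n B N u z Tu vu lu Tz vz lz Hn HG Vu Hu Vz Du Dz Nu)
      as [a1 [b1 [g1 [d1 [E1 H1]]]]].
    assert (E1' : forall i, a1 * lu i + b1 * lz i = g1 * u i + d1 * z i).
    { intro i. exact (f_equal (fun f => f i) E1). }
    assert (Ek := f_equal (dot (S n) k) E1). revert Ek. dots.
    rewrite (dot_sym _ k lu), (dot_sym _ k u), Ouk, Oluk. intro Ek.
    destruct (Req_dec b1 0) as [Z|Hb1].
    - exfalso. rewrite Z in Ek. assert (d1 = 0) as Zd by (apply Rmult_eq_reg_r with (dot (S n) k z); [lra|assumption]).
      destruct H1 as [Ha|]; [|contradiction].
      apply (rev_data_not_parallel n N u Tu vu lu (g1 / a1) Du). vext. specialize (E1' x0).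
      rewrite Z, Zd in E1'. apply Rmult_eq_reg_l with a1; [|assumption].
      replace (a1 * (g1 / a1 * u x0)) with (g1 * u x0) by (field; assumption). lra.
    - assert (Erho : rho = d1 / b1).
      { unfold rho. apply Rmult_eq_reg_l with (b1 * dot (S n) k z).
        - transitivity (b1 * dot (S n) k lz); [field; assumption|].
          transitivity (d1 * dot (S n) k z); [lra|field; assumption].
        - now apply Rmult_integral_contrapositive_currified. }
      exists (g1 / b1), (- a1 / b1). unfold q. rewrite Erho. vext. specialize (E1' x0).
      apply Rmult_eq_reg_l with b1; [|assumption].
      transitivity (b1 * lz x0 - d1 * z x0); [field; assumption|].
      transitivity (g1 * u x0 - a1 * lu x0); [lra|field; assumption]. }
  destruct (Hmeet x lx Tx vx Vx Hx Dx Oxk Olk Nx) as [a1 [b1 E1]].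
  destruct (Hmeet y ly Ty vy Vy Hy Dy Oyk Olyk Ny) as [a2 [b2 E2]].
  (* Eliminates [ly] from two vectors of [P_y]. If the coefficient of [y] vanishes, [p] is a
     multiple of [q] and lies in [P_z], contradicting [Np]; otherwise [y] lies in [P_x], as [p] and
     [q] do. *)
  assert (Hline : forall i, be * q i + b2 * p i = (be * a2 + b2 * de) * y i).
  { intro i. rewrite E2. unfold p, vadd, vsub, vscale. ring. }
  destruct (Req_dec (be * a2 + b2 * de) 0) as [Z|Hc].
  - assert (Hb2 : b2 <> 0).
    { intro Z2. apply (rev_data_not_parallel n N z Tz vz lz rho Dz). vext. specialize (Hline x0).
      rewrite Z, Z2 in Hline. unfold q, vsub, vscale in Hline.
      apply Rmult_eq_reg_l with be; [lra|assumption]. }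
    apply Np. apply parallelogram_sym.
    replace p with (vadd (vscale (be * rho / b2) z) (vscale (- be / b2) lz)).
    + apply (revolution_plane_elliptic n N z Tz vz); auto; [lia|].
      intro Z3. apply Hbe. replace be with (- (- be / b2) * b2) by (field; assumption). rewrite Z3. ring.
    + vext. specialize (Hline x0). rewrite Z in Hline. unfold q, vsub, vscale in Hline.
      apply Rmult_eq_reg_l with b2; [|assumption].
      transitivity (- be * (lz x0 - rho * z x0)); [field; assumption|lra].
  - set (c := be * a2 + b2 * de) in *.
    apply (Hyx ((be * a1 - b2 * ga) / c) ((be * b1 + b2 * al) / c)). vext. specialize (Hline x0).
    rewrite E1, Epx in Hline. unfold vadd, vsub, vscale in Hline.
    apply Rmult_eq_reg_l with c; [|assumption].
    rewrite <- Hline. field. assumption.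
Qed.

Theorem theorem3 (n : nat) (B : pt -> Prop) :
  (4 <= n)%nat ->
  sym_convex_body (S n) B ->
  (forall u, vec (S n) u -> nonzero_vec u ->
     affine_sym_body_of_revolution n (hyperplane (S n) u)
       (section B (hyperplane (S n) u))) ->
  exists u, vec (S n) u /\ nonzero_vec u /\
    ellipsoid n (hyperplane (S n) u) (section B (hyperplane (S n) u)).
Proof.
  intros Hn HB Hrev. destruct (gauge_exists (S n) B HB) as [N HG].
  assert (HR : forall u, vec (S n) u -> u <> vzero -> exists T v, revolution n N u T v).
  { intros u Vu Hu. apply (affine_revolution n B N u HG). apply Hrev; [assumption|].
    now apply nonzero_vec_iff. }
  apply NNPP. intro Hne. apply (no_elliptic_section_absurd n B N Hn HG).
  - intros u Vu Hu. destruct (HR u Vu Hu) as [T [v Hr]].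
    destruct (functional_pushforward n T u v (proj1 Hr) Vu Hu) as [l [Vl Hl]].
    exists T, v, l. now split.
  - intros u Vu Hu Hp. destruct (HR u Vu Hu) as [T [v Hr]]. apply Hne.
    exists u. split; [assumption|]. split; [now apply nonzero_vec_iff|].
    apply (parallelogram_ellipsoid n B N u T v); auto. lia.
Qed.
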